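(* Let $E$ be a $T$-universally complete Riesz space with weak order unit $e=Te$, where $T$ is a strictly positive conditional expectation operator on $E$. Let $(T_i^j)$ be a family of conditional expectation operators on $E$ compatible with $T$ such that $\mathcal{R}(T_{i+1}^{j})\subset\mathcal{R}(T_i^j)\subset\mathcal{R}(T_i^{j+1})$ for all $-\infty<i<j<\infty$. Let $p\in\{1,2,\infty\}$ and let $(f_n)_{n\in\mathbb{Z}}\subset\mathcal{L}^\infty(T)$ be near-epoch dependent in $\mathcal{L}^p(T)$ on $(T_i^j)$, with sequences $(d_n)_{n\in\mathbb{Z}}\subset\mathcal{L}^p(T)_+$ and $(\xi_m)_{m\in\mathbb{N}}\subset\mathcal{R}(T)_+$, $\xi_m\to 0$ in order, satisfying $\|f_n-T_{n-m}^{n+m}f_n\|_{T,p}\le d_n\xi_m$ for all $n\in\mathbb{Z}$, $m\in\mathbb{N}$. Let $g_n\in\mathcal{R}(T)_+$ with $|f_n|\le g_n$ for all $n\in\mathbb{Z}$. Suppose further that $(f_n)_{n\in\mathbb{Z}}$ is $T$-uniform and has $T$-conditional mean zero (that is, $Tf_n=0$ for all $n$), and that $(T_i^j)$ is $\alpha_T$-mixing or $\varphi_T$-mixing. (i) If $\left(\frac1m\sum_{i=n+1}^{n+m} d_i\vee g_i\right)_{m\in\mathbb{N}}$ is bounded in $E$ uniformly in $n\in\mathbb{Z}$, then $$T\left|\frac1m\sum_{i=n+1}^{n+m}f_i\right|\to 0 \text{ in order as } m\to\infty, \text{ uniformly in } n\in\mathbb{Z}.$$ (ii) If $d_n\vee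 g_n=T|f_n|$ for all $n\in\mathbb{Z}$, then $$T\left|\frac1m\sum_{i=n+1}^{n+m}f_i\right|\to 0 \text{ in order as } m\to\infty, \text{ uniformly in } n\in\mathbb{Z}.$$
   Context: Conditional expectation operators. Let $E$ be a Dedekind complete Riesz space with weak order unit. A positive order continuous linear projection $T$ on $E$ whose range $\mathcal{R}(T)$ is a Dedekind complete Riesz subspace of $E$ is a conditional expectation operator if $Te$ is a weak order unit of $E$ for each weak order unit $e$ of $E$. It is strictly positive if $f\ge 0$ and $Tf=0$ imply $f=0$. Another conditional expectation operator $S$ on $E$ is compatible with $T$ if $ST=TS=T$. Multiplication and $T$-universal completeness. A Riesz space is universally complete if it is Dedekind complete and every subset consisting of mutually disjoint elements has a supremum; $E^u$ denotes the universal completion of $E$ (the universally complete Riesz space containing $E$ as an order dense subspace). Given the weak order unit $e=Te$, $E^u$ carries its unique $f$-algebra multiplication with unit $e$; all products are taken in it. $\mathrm{dom}(T)$ is the maximal domain in $E^u$ to which $T$ extends as a conditional expectation operator (the extension is again called $T$); $E$ is $T$-universally complete if $E=\mathrm{dom}(T)$. Spaces and norms. $\mathcal{L}^1(T)=\mathrm{dom}(T)$ ($=E$ here), $\mathcal{L}^2(T)=\{f\in\mathcal{L}^1(T): f^2\in\mathcal{L}^1(T)\}$, $\mathcal{L}^\infty(T)=\{f\in\mathcal{L}^1(T): |f|\le g \text{ for some } g\in\mathcal{R}(T)_+\}$, with $\mathcal{R}(T)_+$-valued norms $\|f\|_{T,1}=T|f|$, $\|f\|_{T,2}=\sqrt{T|f|^2}$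 (the positive square root in the multiplication above), $\|f\|_{T,\infty}=\inf\{g\in\mathcal{R}(T)_+: |f|\le g\}$. Near-epoch dependence. With $(T_i^j)$ (indexed by integers $i\le j$) as in the claim, $(f_n)_{n\in\mathbb{Z}}\subset\mathcal{L}^p(T)$ is near-epoch dependent in $\mathcal{L}^p(T)$ on $(T_i^j)$ if sequences $(d_n)$, $(\xi_m)$ as described in the claim exist ($\mathbb{N}=\{1,2,\dots\}$). Mixing. For a conditional expectation operator $S$, $\mathcal{B}(S)$ is the set of band projections $P$ on $E$ with $Pe\in\mathcal{R}(S)$. For conditional expectation operators $U,V$ on $E$ compatible with $T$, $$\alpha_T(U,V)=\sup\{|TPQe-TPe\cdot TQe| : P\in\mathcal{B}(U), Q\in\mathcal{B}(V)\},$$ $$\varphi_T(U,V)=\sup\{\|UQe-TQe\|_{T,\infty} : Q\in\mathcal{B}(V)\}.$$ For a subset $A\subset E$, $\langle A\rangle$ is the smallest Riesz subspace of $E$ containing $A$ that is closed with respect to order limits in $E$. $T_{-\infty}^n$ and $T_n^\infty$ denote the conditional expectation operators on $E$ compatible with $T$ with ranges $\mathcal{R}(T_{-\infty}^n)=\langle\bigcup_{i\le n}\mathcal{R}(T_i^n)\rangle$ and $\mathcal{R}(T_n^\infty)=\langle\bigcup_{j\ge n}\mathcal{R}(T_n^j)\rangle$ (they exist by a known Radon–Nikodým type theorem). For $m\in\mathbb{N}$ put $\alpha_{T,m}=\sup_{n\in\mathbb{Z}}\alpha_T(T_{-\infty}^n,T_{n+m}^\infty)$ and $\varphi_{T,m}=\sup_{n\in\mathbb{Z}}\varphi_T(T_{-\infty}^n,T_{n+m}^\infty)$.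 The family is $\alpha_T$-mixing (resp. $\varphi_T$-mixing) if $\alpha_{T,m}\to0$ (resp. $\varphi_{T,m}\to0$) in order as $m\to\infty$. $T$-uniformity. For $h\in E_+$, $P_h$ is the band projection onto the band generated by $h$. A net $(f_\alpha)_{\alpha\in\Lambda}$ in $E$ is $T$-uniform if $\sup\{TP_{(|f_\alpha|-ce)^+}|f_\alpha| : \alpha\in\Lambda\}\to0$ in order as $c\to\infty$. Uniformity in $n$. ''Bounded in $E$ uniformly in $n$'' means there is $h\in E_+$ bounding all the averages, for all $m\in\mathbb{N}$ and $n\in\mathbb{Z}$. ''$a_{n,m}\to0$ in order as $m\to\infty$, uniformly in $n$'' (for $a_{n,m}\ge 0$) means there is a sequence $(u_m)_{m\in\mathbb{N}}\subset E_+$ with $u_m\to0$ in order and $a_{n,m}\le u_m$ for all $n\in\mathbb{Z}$, $m\in\mathbb{N}$. *)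

(* Defs.v *)
From HB Require Import structures.
From mathcomp Require Import all_boot all_order all_algebra.
From mathcomp Require Import boolp classical_sets reals.

Set Implicit Arguments.
Unset Strict Implicit.
Unset Printing Implicit Defensive.

Import Order.TTheory GRing.Theory Num.Theory.

Local Open Scope classical_set_scope.
Local Open Scope ring_scope.

(* The lattice operations are fields specified by their universal properties:
   HB rejects a structure joining [Order.Lattice] with [GRing.Zmodule], a missing
   join below [Num.RealDomain]. *)
HB.mixin Record isRieszSpace (R : realType) V
    of GRing.Lmodule R V & Num.POrderedZmodule V := {
  rjoin : V -> V -> V;
  rmeet : V -> V -> V;
  rjoin_leP : forall x y z : V, rjoin x y <= z <-> x <= z /\ y <= z;
  rmeet_geP : forall x y z : V, z <= rmeet x y <-> z <= x /\ z <= y;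
  riesz_lerD2r : forall z x y : V, x <= y -> x + z <= y + z;
  riesz_lerZ : forall (a : R) (x y : V), 0 <= a -> x <= y -> a *: x <= a *: y
}.

#[short(type="rieszType")]
HB.structure Definition RieszSpace (R : realType) :=
  { V of GRing.Lmodule R V & Num.POrderedZmodule V & isRieszSpace R V }.

Notation "x \vee y" := (rjoin x y) (at level 48, left associativity).
Notation "x \wedge y" := (rmeet x y) (at level 48, left associativity).

Section RieszSpaces.
Context {R : realType} {E : rieszType R}.

Definition rabs (x : E) : E := x \vee (- x).
Definition rpos (x : E) : E := x \vee 0.
Definition disjoint_elts (x y : E) : Prop := rabs x \wedge rabs y = 0.

(* Relative version for a subset [A]: suprema are computed inside [A]. *)
Definition dedekind_complete_on (A : set E) : Prop :=
  forall B : set E, B `<=` A -> B !=set0 -> (exists2 u, A u & ubound B u) ->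
  exists2 s, A s & ubound B s /\ forall u, A u -> ubound B u -> s <= u.

Definition directed (I : Type) (le : I -> I -> Prop) : Prop :=
  [/\ exists i : I, True,
      forall i, le i i,
      forall i j k, le i j -> le j k -> le i k &
      forall i j, exists k, le i k /\ le j k].

(* Order convergence of a net: eventual domination of [|f i - l|] by a net
   decreasing to 0.  The domination is only eventual, so finitely many terms
   of a sequence are irrelevant. *)
Definition ocvg (I : Type) (le : I -> I -> Prop) (f : I -> E) (l : E) : Prop :=
  exists v : I -> E,
    [/\ forall i j, le i j -> v j <= v i,
        infimums (range v) 0 &
        exists i0, forall i, le i0 i -> rabs (f i - l) <= v i].

Definition seq_ocvg (f : nat -> E) (l : E) : Prop :=
  ocvg (fun m n : nat => (m <= n)%N) f l.

Definition real_ocvg (f : R -> E) (l : E) : Prop :=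
  ocvg (fun c d : R => c <= d) f l.

Definition order_closed (A : set E) : Prop :=
  forall (I : Type) (le : I -> I -> Prop) (f : I -> E) (l : E),
    directed le -> (forall i, A (f i)) -> ocvg le f l -> A l.

Definition linear_subspace (A : set E) : Prop :=
  A 0 /\ forall (a : R) x y, A x -> A y -> A (a *: x + y).

Definition riesz_subspace (A : set E) : Prop :=
  linear_subspace A /\
  forall x y, A x -> A y -> A (x \vee y) /\ A (x \wedge y).

(* The smallest order closed Riesz subspace containing [A]. *)
Definition riesz_closure (A : set E) : set E :=
  \bigcap_(F in [set F | [/\ riesz_subspace F, order_closed F & A `<=` F]]) F.

Definition is_band (B : set E) : Prop :=
  [/\ linear_subspace B,
      forall x y, B y -> rabs x <= rabs y -> B x &
      order_closed B].

Definition band_gen (h : E) : set E :=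
  \bigcap_(B in [set B | is_band B /\ B h]) B.

Definition weak_order_unit (e : E) : Prop :=
  0 <= e /\ band_gen e = setT.

Definition disjoint_complement (B : set E) : set E :=
  [set x | forall y, B y -> disjoint_elts x y].

(* [P] is the projection onto [B] along [B^d]; this determines [P]. *)
Definition band_projection_onto (B : set E) (P : E -> E) : Prop :=
  is_band B /\ forall x, B (P x) /\ disjoint_complement B (x - P x).

Definition order_continuous (T : E -> E) : Prop :=
  forall (I : Type) (le : I -> I -> Prop) (f : I -> E) (l : E),
    directed le -> ocvg le f l -> ocvg le (T \o f) (T l).

Record cond_exp (T : {linear E -> E}) : Prop := {
  cond_exp_pos : forall x, 0 <= x -> 0 <= T x;
  cond_exp_ocont : order_continuous T;
  cond_exp_idem : forall x, T (T x) = T x;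
  cond_exp_range_riesz : riesz_subspace (range T);
  cond_exp_range_dedekind : dedekind_complete_on (range T);
  cond_exp_unit : forall e, weak_order_unit e -> weak_order_unit (T e)
}.

Definition strictly_positive (T : {linear E -> E}) : Prop :=
  forall x, 0 <= x -> T x = 0 -> x = 0.

Definition compatible (T S : {linear E -> E}) : Prop :=
  forall x, S (T x) = T x /\ T (S x) = T x.

Definition range_pos (T : {linear E -> E}) : set E :=
  [set x | range T x /\ 0 <= x].

End RieszSpaces.

Definition dedekind_complete {R : realType} (E : rieszType R) : Prop :=
  dedekind_complete_on (@setT E).

(* The nonemptiness requirement only excludes the empty set, which has a
   supremum in a Riesz space only if the space is trivial. *)
Definition universally_complete {R : realType} (E : rieszType R) : Prop :=
  dedekind_complete E /\
  forall A : set E, A !=set0 ->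
    (forall x y, A x -> A y -> x <> y -> disjoint_elts x y) ->
    exists s, supremums A s.

Definition riesz_embedding {R : realType} {E F : rieszType R}
    (j : {linear E -> F}) : Prop :=
  [/\ injective j,
      forall x y, j (x \vee y) = j x \vee j y &
      forall x y, j (x \wedge y) = j x \wedge j y].

Definition universal_completion {R : realType} {E Eu : rieszType R}
    (iota : {linear E -> Eu}) : Prop :=
  [/\ riesz_embedding iota,
      universally_complete Eu &
      forall x : Eu, 0 < x -> exists y : E, 0 < iota y /\ iota y <= x].

Record falgebra_mul {R : realType} {E : rieszType R}
    (mul : E -> E -> E) (u : E) : Prop := {
  falg_mulA : forall x y z, mul x (mul y z) = mul (mul x y) z;
  falg_linl : forall a x y z, mul (a *: x + y) z = a *: mul x z + mul y z;
  falg_linr : forall a x y z, mul z (a *: x + y) = a *: mul z x + mul z y;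
  falg_pos : forall x y, 0 <= x -> 0 <= y -> 0 <= mul x y;
  falg_disj : forall x y z, x \wedge y = 0 -> 0 <= z ->
    mul x z \wedge y = 0 /\ mul z x \wedge y = 0;
  falg_mul1 : forall x, mul u x = x /\ mul x u = x
}.

(* A Riesz subspace of [Eu] containing [E] is represented by an embedded Riesz
   space [k : F -> Eu] whose range contains the range of [iota]. *)
Definition cond_exp_extends {R : realType} {E Eu F : rieszType R}
    (iota : {linear E -> Eu}) (T : {linear E -> E}) (k : {linear F -> Eu})
    : Prop :=
  [/\ riesz_embedding k,
      range iota `<=` range k,
      dedekind_complete F,
      exists e : F, weak_order_unit e &
      exists2 T' : {linear F -> F}, cond_exp T' &
        forall (x : E) (y : F), k y = iota x -> k (T' y) = iota (T x)].

Definition is_dom {R : realType} {E Eu : rieszType R}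
    (iota : {linear E -> Eu}) (T : {linear E -> E}) (D : set Eu) : Prop :=
  (exists (F : rieszType R) (k : {linear F -> Eu}),
     cond_exp_extends iota T k /\ range k = D) /\
  forall (F : rieszType R) (k : {linear F -> Eu}),
     cond_exp_extends iota T k -> range k `<=` D.

Definition T_universally_complete {R : realType} {E Eu : rieszType R}
    (iota : {linear E -> Eu}) (T : {linear E -> E}) : Prop :=
  is_dom iota T (range iota).

Variant exponent := p_one | p_two | p_infty.

Section LpSpaces.
Context {R : realType} {E Eu : rieszType R}.
Variables (iota : {linear E -> Eu}) (mul : Eu -> Eu -> Eu).
Variable T : {linear E -> E}.

(* [E = L^1(T)] because [E] is [T]-universally complete. *)
Definition Lp (p : exponent) : set E :=
  match p with
  | p_one => setT
  | p_two => [set f | exists h : E, iota h = mul (iota f) (iota f)]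
  | p_infty => [set f | exists2 g, range_pos T g & rabs f <= g]
  end.

(* [is_Lp_norm p f s]: the [T]-conditional [p]-norm of [f] exists and is [s]. *)
Definition is_Lp_norm (p : exponent) (f s : E) : Prop :=
  match p with
  | p_one => s = T (rabs f)
  | p_two => 0 <= s /\
      exists2 h : E, iota h = mul (iota (rabs f)) (iota (rabs f)) &
        mul (iota s) (iota s) = iota (T h)
  | p_infty => infimums [set g | range_pos T g /\ rabs f <= g] s
  end.

Definition near_epoch_dependent_with (p : exponent)
    (Tij : int -> int -> {linear E -> E}) (f d : int -> E) (xi : nat -> E)
    : Prop :=
  [/\ forall n, Lp p (f n),
      forall n, Lp p (d n) /\ 0 <= d n,
      forall m, (0 < m)%N -> range_pos T (xi m),
      seq_ocvg xi 0 &
      forall (n : int) (m : nat), (0 < m)%N ->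
        exists2 s, is_Lp_norm p (f n - Tij (n - m%:Z) (n + m%:Z) (f n)) s &
          iota s <= mul (iota (d n)) (iota (xi m))].

Variable e : E.

Definition event_projections (S : {linear E -> E}) : set (E -> E) :=
  [set P | (exists B, band_projection_onto B P) /\ range S (P e)].

(* The product [TPe . TQe] lives in [Eu], and so does this coefficient. *)
Definition is_alpha (U V : {linear E -> E}) (a : Eu) : Prop :=
  supremums [set x | exists P Q,
    [/\ event_projections U P, event_projections V Q &
        x = rabs (iota (T (P (Q e))) - mul (iota (T (P e))) (iota (T (Q e))))]]
    a.

Definition is_phi (U V : {linear E -> E}) (a : E) : Prop :=
  supremums [set x | exists2 Q, event_projections V Q &
    is_Lp_norm p_infty (U (Q e) - T (Q e)) x] a.

(* [Tpast n] is the operator $T_{-\infty}^n$ and [Tfut n] is $T_n^\infty$. *)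
Definition alpha_mixing (Tpast Tfut : int -> {linear E -> E}) : Prop :=
  exists (a : int -> nat -> Eu) (am : nat -> Eu),
    [/\ forall n m, (0 < m)%N -> is_alpha (Tpast n) (Tfut (n + m%:Z)) (a n m),
        forall m, (0 < m)%N -> supremums [set a n m | n in setT] (am m) &
        seq_ocvg am 0].

Definition phi_mixing (Tpast Tfut : int -> {linear E -> E}) : Prop :=
  exists (a : int -> nat -> E) (am : nat -> E),
    [/\ forall n m, (0 < m)%N -> is_phi (Tpast n) (Tfut (n + m%:Z)) (a n m),
        forall m, (0 < m)%N -> supremums [set a n m | n in setT] (am m) &
        seq_ocvg am 0].

(* The supremum may fail to exist for small [c]; it must exist eventually. *)
Definition T_uniform (L : Type) (f : L -> E) : Prop :=
  exists (c0 : R) (u : R -> E),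
    (forall c, c0 <= c ->
       supremums [set x | exists (l : L) (P : E -> E),
         band_projection_onto (band_gen (rpos (rabs (f l) - c *: e))) P /\
         x = T (P (rabs (f l)))] (u c)) /\
    real_ocvg u 0.

End LpSpaces.

Section Averages.
Context {R : realType} {E : rieszType R}.

(* The average of [f i] over [i = n+1, ..., n+m]. *)
Definition block_mean (f : int -> E) (n : int) (m : nat) : E :=
  (m%:R)^-1 *: \sum_(1 <= k < m.+1) f (n + k%:Z).

Definition bounded_uniformly (a : int -> nat -> E) : Prop :=
  exists2 h : E, 0 <= h & forall n m, (0 < m)%N -> a n m <= h.

Definition ocvg0_uniformly (a : int -> nat -> E) : Prop :=
  exists u : nat -> E,
    [/\ forall m, (0 < m)%N -> 0 <= u m,
        seq_ocvg u 0 &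
        forall n m, (0 < m)%N -> a n m <= u m].

End Averages.

(* Main.v *)
Require Import Defs.
From HB Require Import structures.
From mathcomp Require Import all_boot all_order all_algebra.
From mathcomp Require Import ring lra zify.
From mathcomp Require Import boolp classical_sets reals.

Set Implicit Arguments.
Unset Strict Implicit.
Unset Printing Implicit Defensive.

Import Order.TTheory GRing.Theory Num.Theory.

Local Open Scope classical_set_scope.
Local Open Scope ring_scope.

(* In both cases some h in E dominates all d_n and g_n: in (i) take m = 1, and in
   (ii) T-uniformity bounds the T|f_n|.  Hence |f_n| <= G := T h in R(T) and all
   estimates may be made on the truncations of f_n at K e, up to multiples of
   r_K = (G - K e)^+, which decreases to 0.

   Let S_n be the expectation onto the past of n.  Near-epoch dependence makes
   T|f_n - S_{n+M} f_n| small, and mixing makes T|S_{n-2M} f_n| small: for y in the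
   range of T_{n-M}^{n+M}, truncated at K e, a sum of multiples of components Q_k e
   with Q_k in B(T_{n-M}^infty) approximates y, and the mixing coefficient bounds the
   contribution of each Q_k.  Between these two levels f_n telescopes into 3M martingale
   differences.  To avoid L^2 orthogonality, the mean of a martingale with differences
   bounded by C e is estimated with the convex piecewise linear function
   phi(x) = sum_{k <= N} |x - 2Ck e|: one step of the martingale increases T phi by at
   most 2C e, and N |x| <= phi(x) + 2CN^2 e. *)

(** * Linear identities in modules *)

(** All three exponents are reduced to [p_one] by the inequality between [T (rabs x)] and the
    [p]-norm of [x]. Compatibility relates the operators only to [T]. Identities between them, such
    as the tower property, are therefore obtained by testing against band projections [P] with [P e]
    in a range and then invoking strict positivity. Band projections also take the place of
    multiplication by signs and indicators, and they commute with conditional expectations on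
    elements bounded by a multiple of [e]; this is the reason for truncating. The products
    [d_n xi_m] and the alpha coefficients are elements of [Eu], while the null sequence sought is
    one in [E]; a criterion on suprema of tails that accepts bounds from [Eu] bridges the two. The
    parameters are fixed in the order truncation level [K], window [M], number [N] of kinks of phi,
    block length [m]. A single element of [E] below all the bounds is then compared with them, and
    the parameters tend to infinity in the reverse order. *)

Inductive vterm (R : Type) :=
  | VZero | VAtom of nat | VAdd of vterm R & vterm R | VOpp of vterm R
  | VScale of R & vterm R | VMuln of vterm R & nat.
Arguments VZero {R}.
Arguments VAtom {R}.

Section LinearNormalization.
Context {R : nzRingType} {V : lmodType R}.

Fixpoint veval (env : seq V) (t : vterm R) : V :=
  match t with
  | VZero => 0
  | VAtom i => nth 0 env i
  | VAdd t u => veval env t + veval env u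
  | VOpp t => - veval env t
  | VScale a t => a *: veval env t
  | VMuln t n => veval env t *+ n
  end.

(** [Nat.eqb] lets the restricted [cbv] of the tactic below decide which atoms coincide while the
    scalars stay folded. *)
Fixpoint vcoef (t : vterm R) (i : nat) : R :=
  match t with
  | VZero => 0
  | VAtom j => if Nat.eqb j i then 1 else 0
  | VAdd t u => vcoef t i + vcoef u i
  | VOpp t => - vcoef t i
  | VScale a t => a * vcoef t i
  | VMuln t n => vcoef t i * n%:R
  end.

(** For a concrete list of atoms this conjunction unfolds to one scalar equation per atom. *)
Fixpoint same_coefs (n : nat) (t u : vterm R) : Prop :=
  match n with
  | 0%N => True
  | n.+1 => vcoef t n = vcoef u n /\ same_coefs n t u
  end.

Lemma veval_coef env t :
  veval env t = \sum_(i < size env) vcoef t i *: env`_i.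
Proof.
elim: t => [|j|t IHt u IHu|t IHt|a t IHt|t IHt n] /=; rewrite ?IHt ?IHu.
- by rewrite big1 // => i _; rewrite scale0r.
- have [ltj|gej] := ltnP j (size env); last first.
    rewrite nth_default // big1 // => i _.
    case: PeanoNat.Nat.eqb_spec => [ji|_]; last by rewrite scale0r.
    by move: (ltn_ord i); rewrite -ji ltnNge gej.
  rewrite (bigD1 (Ordinal ltj)) //= PeanoNat.Nat.eqb_refl scale1r big1 ?addr0 //.
  move=> i /eqP ij; case: PeanoNat.Nat.eqb_spec => [ji|_]; last by rewrite scale0r.
  by case: ij; apply: val_inj.
- by rewrite -big_split; apply: eq_bigr => i _; rewrite scalerDl.
- by rewrite -sumrN; apply: eq_bigr => i _; rewrite scaleNr.
- by rewrite scaler_sumr; apply: eq_bigr => i _; rewrite scalerA.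
- by rewrite -sumrMnl; apply: eq_bigr => i _; rewrite mulr_natr scalerMnl.
Qed.

Lemma veval_eq env t u : same_coefs (size env) t u -> veval env t = veval env u.
Proof.
move=> tu; rewrite !veval_coef; apply: eq_bigr => i _; congr (_ *: _).
move: (nat_of_ord i) (ltn_ord i) => k.
elim: (size env) tu => // n IHn /= [tun /IHn lt_n]; rewrite ltnS leq_eqVlt.
by case/orP=> [/eqP -> |/lt_n].
Qed.

End LinearNormalization.

Ltac vindex x env :=
  lazymatch env with
  | ?y :: ?s =>
    match constr:(Set) with
    | _ => let _ := match constr:(Set) with _ => unify x y end in constr:(0%N)
    | _ => let n := vindex x s in constr:(n.+1)
    end
  end.
Ltac vinsert x env :=
  match constr:(Set) with
  | _ => let _ := vindex x env in env
  | _ => constr:(x :: env)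
  end.
Ltac vatoms t env :=
  lazymatch t with
  | @GRing.zero _ => env
  | @GRing.add _ ?a ?b => let env := vatoms a env in vatoms b env
  | @GRing.opp _ ?a => vatoms a env
  | @GRing.scale _ _ _ ?a => vatoms a env
  | @GRing.natmul _ ?a _ => vatoms a env
  | _ => vinsert t env
  end.
Ltac vreify R t env :=
  lazymatch t with
  | @GRing.zero _ => constr:(@VZero R)
  | @GRing.add _ ?a ?b =>
    let a := vreify R a env in let b := vreify R b env in constr:(@VAdd R a b)
  | @GRing.opp _ ?a => let a := vreify R a env in constr:(@VOpp R a)
  | @GRing.scale _ _ ?c ?a => let a := vreify R a env in constr:(@VScale R c a)
  | @GRing.natmul _ ?a ?n => let a := vreify R a env in constr:(@VMuln R a n)
  | _ => let n := vindex t env in constr:(@VAtom R n)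
  end.
(* [vring] and [vfield] prove linear identities between elements of an [lmodType] by
   comparing the coefficients of the atoms with [ring] or [field]. *)
Ltac vring_with tac :=
  lazymatch goal with
  | |- @eq ?V0 ?x ?y =>
    let V := constr:(GRing.Lmodule.clone _ V0 _) in
    let R := lazymatch type of V with GRing.Lmodule.type ?R => R end in
    let env0 := constr:(@nil V0) in
    let env := vatoms x env0 in let env := vatoms y env in
    let t := vreify R x env in let u := vreify R y env in
    refine (@veval_eq R V env t u _);
    cbv [same_coefs vcoef size Nat.eqb]; repeat split; tac
  end.
Ltac vring := vring_with ltac:(ring).
Ltac vfield := vring_with ltac:(field).

(** * Riesz space arithmetic *)

Section RieszArithmetic.
Context {R : realType} {E : rieszType R}.
Implicit Types x y z a b c : E.

Lemma riesz_leD a b c d : a <= b -> c <= d -> a + c <= b + d.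
Proof.
move=> ab cd; apply: le_trans (riesz_lerD2r c _ _ ab) _.
by rewrite ![b + _]addrC; apply: riesz_lerD2r.
Qed.

(** The order is translation invariant, so only the difference of the two sides matters. Linear
    estimates below are proved by adding known inequalities and checking the differences with
    [vring]. *)
Lemma riesz_le_by x y a b : a <= b -> y - x = b - a -> x <= y.
Proof.
move=> /(riesz_lerD2r (- a)); rewrite subrr => ab yx.
by move: ab; rewrite -yx => /(riesz_lerD2r x); rewrite add0r subrK.
Qed.

Lemma riesz_leN x y : x <= y -> - y <= - x.
Proof. by move=> xy; apply: (riesz_le_by xy); vring. Qed.

Lemma riesz_sub_ge0 x y : 0 <= y - x <-> x <= y.
Proof. by split=> xy; apply: (riesz_le_by xy); vring. Qed.

Lemma riesz_addr_ge0 x y : 0 <= x -> 0 <= y -> 0 <= x + y.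
Proof. by move=> x0 y0; have := riesz_leD x0 y0; rewrite addr0. Qed.

Lemma riesz_scale_ge0 (t : R) x : 0 <= t -> 0 <= x -> 0 <= t *: x.
Proof. by move=> t0 x0; have := riesz_lerZ t _ _ t0 x0; rewrite scaler0. Qed.

Lemma riesz_scale2 (s t : R) x : s <= t -> 0 <= x -> s *: x <= t *: x.
Proof.
move=> st x0; have h := riesz_scale_ge0 (t := t - s) _ x0.
by apply: (riesz_le_by (h _)); [rewrite subr_ge0|vring].
Qed.

Lemma riesz_le_scale (t : R) x y : 0 < t -> x <= y -> t *: x <= t *: y.
Proof. by move=> t0; apply: riesz_lerZ; apply: ltW. Qed.

Lemma riesz_le_unscale (t : R) x y : 0 < t -> t *: x <= t *: y -> x <= y.
Proof.
move=> t0 /(riesz_lerZ t^-1 _ _ (ltW _)); rewrite !scalerA mulVf ?gt_eqF //.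
by rewrite !scale1r; apply; rewrite invr_gt0.
Qed.

Lemma riesz_sum_le (I : Type) (r : seq I) (P : pred I) (F G : I -> E) :
  (forall i, P i -> F i <= G i) -> \sum_(i <- r | P i) F i <= \sum_(i <- r | P i) G i.
Proof. by move=> FG; elim/big_ind2: _ => // a b c d; apply: riesz_leD. Qed.

Lemma riesz_sum_ge0 (I : Type) (r : seq I) (P : pred I) (F : I -> E) :
  (forall i, P i -> 0 <= F i) -> 0 <= \sum_(i <- r | P i) F i.
Proof. by move=> F0; elim/big_ind: _ => //; apply: riesz_addr_ge0. Qed.

Lemma rjoin_lub x y z : x <= z -> y <= z -> x \vee y <= z.
Proof. by move=> xz yz; apply/rjoin_leP. Qed.
Lemma rjoin_ub x y : x <= x \vee y /\ y <= x \vee y.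
Proof. by apply/rjoin_leP. Qed.
Lemma rmeet_glb x y z : z <= x -> z <= y -> z <= x \wedge y.
Proof. by move=> xz yz; apply/rmeet_geP. Qed.
Lemma rmeet_lb x y : x \wedge y <= x /\ x \wedge y <= y.
Proof. by apply/rmeet_geP. Qed.

Lemma rjoinC x y : x \vee y = y \vee x.
Proof.
by apply: le_anti; apply/andP; split; apply: rjoin_lub; apply rjoin_ub.
Qed.
Lemma rmeetC x y : x \wedge y = y \wedge x.
Proof.
by apply: le_anti; apply/andP; split; apply: rmeet_glb; apply rmeet_lb.
Qed.

Lemma rmeetS a b c d : a <= c -> b <= d -> a \wedge b <= c \wedge d.
Proof.
have [h1 h2] := rmeet_lb a b.
by move=> ac bd; apply: rmeet_glb; [apply: le_trans ac|apply: le_trans bd].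
Qed.

Lemma rmeet_ge0 x y : 0 <= x -> 0 <= y -> 0 <= x \wedge y.
Proof. exact: rmeet_glb. Qed.

Lemma rmeet_idl x y : x <= y -> x \wedge y = x.
Proof.
move=> xy; apply: le_anti; apply/andP; split; first by apply rmeet_lb.
by apply: rmeet_glb.
Qed.

Lemma rjoinDr z x y : (x + z) \vee (y + z) = (x \vee y) + z.
Proof.
have [h1 h2] := rjoin_ub x y; have [h3 h4] := rjoin_ub (x + z) (y + z).
apply: le_anti; apply/andP; split.
  by apply: rjoin_lub; apply: riesz_lerD2r.
have h : x \vee y <= (x + z) \vee (y + z) - z.
  apply: rjoin_lub; first by apply: (riesz_le_by h3); vring.
  by apply: (riesz_le_by h4); vring.
by apply: (riesz_le_by h); vring.
Qed.

Lemma rmeetN x y : (- x) \wedge (- y) = - (x \vee y).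
Proof.
have [h1 h2] := rjoin_ub x y; have [h3 h4] := rmeet_lb (- x) (- y).
apply: le_anti; apply/andP; split; last first.
  by apply: rmeet_glb; apply: riesz_leN.
have h : x \vee y <= - ((- x) \wedge (- y)).
  apply: rjoin_lub; first by apply: (riesz_le_by h3); vring.
  by apply: (riesz_le_by h4); vring.
by apply: (riesz_le_by h); vring.
Qed.

Lemma rmeetDr z x y : (x + z) \wedge (y + z) = (x \wedge y) + z.
Proof.
rewrite -[x + z]opprK -[y + z]opprK rmeetN -[x in RHS]opprK -[y in RHS]opprK.
by rewrite rmeetN !opprD rjoinDr; vring.
Qed.

Lemma rpos_ge0 x : 0 <= rpos x. Proof. by apply rjoin_ub. Qed.
Lemma rpos_ge x : x <= rpos x. Proof. by apply rjoin_ub. Qed.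
Lemma rpos_lub x z : x <= z -> 0 <= z -> rpos x <= z.
Proof. exact: rjoin_lub. Qed.
Lemma rposS x y : x <= y -> rpos x <= rpos y.
Proof.
by move=> xy; apply: rpos_lub (rpos_ge0 _); apply: le_trans (rpos_ge _).
Qed.
Lemma rpos_id x : 0 <= x -> rpos x = x.
Proof.
by move=> x0; apply: le_anti; rewrite rpos_ge rpos_lub.
Qed.
Lemma rpos_eq0 x : x <= 0 -> rpos x = 0.
Proof. by move=> x0; apply: le_anti; rewrite rpos_ge0 rpos_lub. Qed.

Lemma rpos_sub x : rpos x - rpos (- x) = x.
Proof.
have := rjoinDr (- x) x 0; rewrite subrr add0r rjoinC => h.
by rewrite {2}/rpos h -/(rpos x); vring.
Qed.

Lemma rabs_lub x z : x <= z -> - x <= z -> rabs x <= z.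
Proof. exact: rjoin_lub. Qed.
Lemma rabs_ge x : x <= rabs x. Proof. by apply rjoin_ub. Qed.
Lemma rabs_geN x : - x <= rabs x. Proof. by apply rjoin_ub. Qed.

Lemma rabsE x : rabs x = rpos x + rpos (- x).
Proof.
have xE := rpos_sub x.
have -> : rpos x + rpos (- x) = rpos x *+ 2 - x by rewrite -{4}xE; vring.
rewrite -scaler_nat; apply: le_anti; apply/andP; split.
  apply: rabs_lub.
    by have h := riesz_leD (rpos_ge x) (rpos_ge x); apply: (riesz_le_by h); vring.
  by have h := riesz_leD (rpos_ge0 x) (rpos_ge0 x); apply: (riesz_le_by h); vring.
have half_ge0 : 0 <= 2^-1 :> R by rewrite invr_ge0 ler0n.
have h : rpos x <= 2^-1 *: (rabs x + x).
  apply: rpos_lub.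
    have h := riesz_lerZ 2^-1 _ _ half_ge0 (rabs_ge x).
    by apply: (riesz_le_by h); vfield.
  apply: riesz_scale_ge0 half_ge0 _.
  by have h := rabs_geN x; apply: (riesz_le_by h); vring.
by apply: (riesz_le_by (riesz_leD h h)); vfield.
Qed.

Lemma rpos_le_abs x : rpos x <= rabs x.
Proof.
by rewrite rabsE; have h := rpos_ge0 (- x); apply: (riesz_le_by h); vring.
Qed.
Lemma rneg_le_abs x : rpos (- x) <= rabs x.
Proof. by rewrite rabsE; have h := rpos_ge0 x; apply: (riesz_le_by h); vring. Qed.
Lemma rabs_ge0 x : 0 <= rabs x.
Proof. exact: le_trans (rpos_ge0 x) (rpos_le_abs x). Qed.
Lemma rabsN x : rabs (- x) = rabs x.
Proof. by rewrite !rabsE opprK addrC. Qed.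
Lemma rabs_id x : 0 <= x -> rabs x = x.
Proof.
move=> x0; rewrite rabsE rpos_id // rpos_eq0 ?addr0 //.
by apply: (riesz_le_by x0); vring.
Qed.
Lemma rabs_eq0 x : rabs x = 0 -> x = 0.
Proof.
move=> h; have h1 := rabs_ge x; have h2 := rabs_geN x; rewrite h in h1 h2.
by apply: le_anti; rewrite h1 /=; apply: (riesz_le_by h2); vring.
Qed.
Lemma rabs0 : rabs (0 : E) = 0. Proof. exact: rabs_id. Qed.

Lemma rabsD x y : rabs (x + y) <= rabs x + rabs y.
Proof.
apply: rabs_lub; first by apply: riesz_leD; apply: rabs_ge.
by rewrite opprD; apply: riesz_leD; apply: rabs_geN.
Qed.
Lemma rabsB x y : rabs (x - y) <= rabs x + rabs y.
Proof. by rewrite -(rabsN y); apply: rabsD. Qed.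

Lemma rabs_sum_le (I : Type) (r : seq I) (P : pred I) (F : I -> E) :
  rabs (\sum_(i <- r | P i) F i) <= \sum_(i <- r | P i) rabs (F i).
Proof.
elim/big_ind2: _ => [|x a y b xa yb|//]; first by rewrite rabs0.
by apply: le_trans (rabsD _ _) (riesz_leD xa yb).
Qed.

Lemma rabsZ (t : R) x : 0 <= t -> rabs (t *: x) = t *: rabs x.
Proof.
rewrite le_eqVlt => /orP[/eqP <-|t0]; first by rewrite !scale0r rabs0.
have le (s : R) y : 0 < s -> rabs (s *: y) <= s *: rabs y.
  move=> s0; apply: rabs_lub; last rewrite -scalerN.
    by apply: riesz_le_scale s0 (rabs_ge _).
  by apply: riesz_le_scale s0 (rabs_geN _).
apply: le_anti; rewrite le //=; apply: (@riesz_le_unscale t^-1).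
  by rewrite invr_gt0.
have := le t^-1 (t *: x); rewrite !scalerA mulVf ?gt_eqF // !scale1r.
by apply; rewrite invr_gt0.
Qed.

Lemma rabs_le_itv x z : rabs x <= z -> - z <= x /\ x <= z.
Proof.
move=> xz; split; last exact: le_trans (rabs_ge _) xz.
by have h := le_trans (rabs_geN x) xz; apply: (riesz_le_by h); vring.
Qed.

Lemma rpos_meet x : rpos x \wedge rpos (- x) = 0.
Proof.
have -> : rpos (- x) = rpos x - x.
  by have h := rpos_sub x; rewrite -{3}h; vring.
rewrite -[rpos x in X in X \wedge _]add0r [rpos x - x]addrC rmeetDr.
by have := rmeetN 0 x; rewrite oppr0 => ->; rewrite rjoinC addNr.
Qed.

(** With [t] the left side, [t - a \wedge c] is the join of [t - a] and [t - c]. The first is at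
    most 0 and the second is at most both [a] and [b]. *)
Lemma rmeetDr_le a b c : 0 <= a -> 0 <= b -> 0 <= c ->
  a \wedge (b + c) <= a \wedge b + a \wedge c.
Proof.
move=> a0 b0 c0; have [ta tbc] := rmeet_lb a (b + c).
set t := _ \wedge (b + c) in ta tbc *.
have h : t - a \wedge c <= a \wedge b.
  rewrite -[c]opprK -[a in X in _ - X]opprK rmeetN opprK addrC -rjoinDr.
  apply: rjoin_lub; last first.
    apply: rmeet_glb; last by apply: (riesz_le_by tbc); vring.
    by apply: (riesz_le_by (riesz_leD ta c0)); vring.
  have h : - a + t <= 0 by apply: (riesz_le_by ta); vring.
  by apply: le_trans h (rmeet_ge0 _ _).
by apply: (riesz_le_by h); vring.
Qed.

Lemma meet_eq0_le a b a' b' : 0 <= a' -> 0 <= b' -> a' <= a -> b' <= b ->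
  a \wedge b = 0 -> a' \wedge b' = 0.
Proof.
move=> a0 b0 aa bb ab; apply: le_anti; rewrite rmeet_ge0 // andbT -ab.
exact: rmeetS.
Qed.

Lemma meet_eq0D a b c : 0 <= a -> 0 <= b -> 0 <= c ->
  a \wedge b = 0 -> a \wedge c = 0 -> a \wedge (b + c) = 0.
Proof.
move=> a0 b0 c0 ab ac; apply: le_anti; rewrite rmeet_ge0 ?riesz_addr_ge0 // andbT.
by apply: le_trans (rmeetDr_le _ _ _) _; rewrite // ab ac addr0.
Qed.

Lemma meet_eq0Z (t : R) a b : 0 <= a -> 0 <= b -> 0 <= t ->
  a \wedge b = 0 -> a \wedge (t *: b) = 0.
Proof.
move=> a0 b0 t0 ab; have [n tn] : exists n : nat, t <= n%:R.
  by exists (Num.bound t); apply: ltW; apply: archi_boundP.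
have h : a \wedge (n%:R *: b) = 0.
  elim: n {tn} => [|n IHn].
    by rewrite scale0r; apply: le_anti; rewrite rmeet_ge0 // andbT; apply rmeet_lb.
  by rewrite -addn1 natrD scalerDl scale1r meet_eq0D // riesz_scale_ge0.
apply: meet_eq0_le h => //; first exact: riesz_scale_ge0.
exact: riesz_scale2.
Qed.

Lemma rpos_le_meet0 z x y : rpos z <= x -> rpos z <= y -> x \wedge y = 0 -> z <= 0.
Proof.
move=> zx zy xy; apply: le_trans (rpos_ge z) _.
by rewrite -xy; apply: rmeet_glb.
Qed.

Lemma disjoint_eltsC x y : disjoint_elts x y -> disjoint_elts y x.
Proof. by rewrite /disjoint_elts rmeetC. Qed.

Lemma disjoint_pos x y : 0 <= x -> 0 <= y -> disjoint_elts x y <-> x \wedge y = 0.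
Proof. by move=> x0 y0; rewrite /disjoint_elts !rabs_id. Qed.

Lemma disjoint_self x : disjoint_elts x x -> x = 0.
Proof. by rewrite /disjoint_elts rmeet_idl // => /rabs_eq0. Qed.

End RieszArithmetic.
#[global] Hint Extern 0 (is_true (_ <= rpos _)) => exact: rpos_ge0 : core.
#[global] Hint Extern 0 (is_true (_ <= rabs _)) => exact: rabs_ge0 : core.

(** * Bands and band projections *)

Section DedekindComplete.
Context {R : realType} {E : rieszType R}.
Hypothesis E_ded : dedekind_complete E.
Implicit Types (x y z a b c h e u w : E) (A B : set E).

Lemma ded_sup A b : A !=set0 -> ubound A b -> exists s, supremums A s.
Proof.
move=> A0 Ab; case: (@E_ded A) => // [|s _ [As sA]]; first by exists b.
by exists s; split=> // u Au; apply: sA.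
Qed.

Lemma ded_inf A b : A !=set0 -> lbound A b -> exists s, infimums A s.
Proof.
move=> A0 Ab; have [s [sl su]] : exists s, supremums (lbound A) s.
  case: A0 => a Aa; apply: (@ded_sup _ a); first by exists b.
  by move=> x /(_ a Aa).
exists s; split=> [x Ax|x]; last exact: sl.
by apply: su => y /(_ x Ax).
Qed.

(** The supremum [s] of the multiples of [x] also bounds the multiples shifted by one, so
    [s <= s - x]. *)
Lemma riesz_archimedean x y : (forall n : nat, n%:R *: x <= y) -> x <= 0.
Proof.
move=> xy; have [s [su sl]] : exists s, supremums (range (fun n : nat => n%:R *: x)) s.
  apply: (@ded_sup _ y); first by exists (0%:R *: x), 0%N.
  by move=> _ [n _ <-].
have h : s <= s - x.
  apply: sl => _ [n _ <-].
  have h : n.+1%:R *: x <= s by apply: su; exists n.+1.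
  by apply: (riesz_le_by h); rewrite -(@natr1 R n); vring.
by apply: (riesz_le_by h); vring.
Qed.

Lemma riesz_archimedean_eps x y : 0 <= y ->
  (forall t : R, 0 < t -> x <= t *: y) -> x <= 0.
Proof.
move=> y0 xy; apply: (@riesz_archimedean _ y) => -[|n]; first by rewrite scale0r.
apply: (@riesz_le_unscale _ _ n.+1%:R^-1); first by rewrite invr_gt0 ltr0Sn.
rewrite scalerA mulVf ?pnatr_eq0 // scale1r.
by apply: xy; rewrite invr_gt0 ltr0Sn.
Qed.

Lemma le0_of_null (v : nat -> E) (t : R) x : infimums (range v) 0 -> 0 <= t ->
  (forall m, x <= t *: v m) -> x <= 0.
Proof.
move=> [_ v0]; rewrite le_eqVlt => /orP[/eqP <- xv|t0 xv].
  by have := xv 0%N; rewrite scale0r.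
apply: (@riesz_le_unscale _ _ t^-1); rewrite ?invr_gt0 // scaler0.
apply: v0 => _ [m _ <-]; apply: (riesz_le_unscale t0).
by rewrite scalerA mulfV ?gt_eqF // scale1r.
Qed.

(** The two sequences share the index [m]. Monotonicity detaches them: an index beyond both [i] and
    [j] gives the bound with [v i] and [w j], and the two infima are taken separately. *)
Lemma le0_of_nullD (v w : nat -> E) (s t : R) x :
  (forall i j, (i <= j)%N -> v j <= v i) -> (forall i j, (i <= j)%N -> w j <= w i) ->
  infimums (range v) 0 -> infimums (range w) 0 -> 0 <= s -> 0 <= t ->
  forall m0, (forall m, (m0 <= m)%N -> x <= s *: v m + t *: w m) -> x <= 0.
Proof.
move=> va wa v0 w0 s0 t0 m0 xvw; apply: (le0_of_null v0 s0) => i.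
have h : x - s *: v i <= 0.
  apply: (le0_of_null w0 t0) => j; set k := (m0 + (i + j))%N.
  have h1 := riesz_lerZ _ _ _ s0 (va i k _); have h2 := riesz_lerZ _ _ _ t0 (wa j k _).
  have h3 := riesz_leD (riesz_leD (h1 _) (h2 _)) (xvw k _).
  apply: (riesz_le_by (h3 _ _ _)); rewrite /k; try lia.
  by vring.
by apply: (riesz_le_by h); vring.
Qed.

Lemma seq_ocvg_unique (f : nat -> E) x y : seq_ocvg f x -> seq_ocvg f y -> x = y.
Proof.
move=> [v [va v0 [i0 fx]]] [w [wa w0 [j0 fy]]]; apply/eqP; rewrite -subr_eq0.
apply/eqP; apply: rabs_eq0; apply: le_anti; rewrite rabs_ge0 andbT.
apply: (@le0_of_nullD v w 1 1 _ va wa v0 w0 _ _ (i0 + j0)%N) => // m lem.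
rewrite !scale1r; have -> : x - y = - (f m - x) + (f m - y) by vring.
apply: le_trans (rabsD _ _) _; rewrite rabsN.
by apply: riesz_leD; [apply: fx|apply: fy]; lia.
Qed.

Lemma seq_ocvg_sup (f : nat -> E) s : (forall i j, (i <= j)%N -> f i <= f j) ->
  supremums (range f) s -> seq_ocvg f s.
Proof.
move=> fi [fs sf]; exists (fun i => s - f i); split.
- by move=> i j /fi h; apply: (riesz_le_by h); vring.
- split=> [_ [i _ <-]|y ylb].
    by apply/riesz_sub_ge0; apply: fs; exists i.
  have h : s <= s - y.
    apply: sf => _ [i _ <-]; have h : y <= s - f i by apply: ylb; exists i.
    by apply: (riesz_le_by h); vring.
  by apply: (riesz_le_by h); vring.
exists 0%N => i _; rewrite -rabsN rabs_id; first by rewrite opprB.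
by rewrite opprB; apply/riesz_sub_ge0; apply: fs; exists i.
Qed.

Lemma nat_directed : directed (fun m n : nat => (m <= n)%N).
Proof.
split; [by exists 0%N|by []|by move=> i j k; apply: leq_trans|].
by move=> i j; exists (maxn i j); rewrite leq_maxl leq_maxr.
Qed.

(** An increasing sequence converges in order to its supremum, and an order continuous operator that
    fixes the terms fixes the limit. *)
Lemma range_cond_exp_sup (S : {linear E -> E}) (f : nat -> E) s : cond_exp S ->
  (forall i, range S (f i)) -> (forall i j, (i <= j)%N -> f i <= f j) ->
  supremums (range f) s -> range S s.
Proof.
move=> S_ce Sf fi fs; have fc := seq_ocvg_sup fi fs.
exists s => //; apply: (@seq_ocvg_unique f) => //.
have := cond_exp_ocont S_ce nat_directed fc; congr (ocvg _ _ _).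
apply: funext => i /=; have [x _ <-] := Sf i; exact: cond_exp_idem.
Qed.

Lemma rabsZ_norm (t : R) x : rabs (t *: x) = `|t| *: rabs x.
Proof.
have [t0|t0] := leP 0 t; first by rewrite rabsZ // ger0_norm.
rewrite ltr0_norm // -rabsN -scaleNr rabsZ // oppr_ge0; exact: ltW.
Qed.

Lemma disjoint_complement_band A : is_band (disjoint_complement A).
Proof.
split.
- split=> [y _|t x y Ax Ay z Az]; rewrite /disjoint_elts.
    by rewrite rabs0 rmeet_idl.
  have h : rabs z \wedge (`|t| *: rabs x + rabs y) = 0.
    have tx0 : 0 <= `|t| *: rabs x by apply: riesz_scale_ge0.
    apply: meet_eq0D => //; last by rewrite rmeetC; apply: Ay.
    by apply: meet_eq0Z => //; rewrite rmeetC; apply: Ax.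
  rewrite rmeetC; apply: meet_eq0_le h => //.
  by apply: le_trans (rabsD _ _) _; rewrite rabsZ_norm.
- by move=> x y Ay xy z Az; apply: meet_eq0_le (Ay z Az).
move=> I le f l [_ _ _ ub] Af [v [va [v0 v0'] [i0 fl]]] z Az.
apply: le_anti; rewrite rmeet_ge0 // andbT; apply: v0' => _ [i _ <-].
have [k [ik i0k]] := ub i i0; apply: le_trans (va _ _ ik).
have h : rabs l \wedge rabs z <= rabs z \wedge (rabs (f k - l) + rabs (f k)).
  rewrite rmeetC; apply: rmeetS => //; rewrite -(rabsN (f k - l)).
  have {1}-> : l = - (f k - l) + f k by vring.
  exact: rabsD.
apply: le_trans h _; apply: le_trans (rmeetDr_le _ _ _) _ => //.
have := Af k z Az; rewrite /disjoint_elts rmeetC => ->; rewrite addr0.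
by apply: le_trans (fl k i0k); apply rmeet_lb.
Qed.

Lemma band_gen_self h : band_gen h h.
Proof. by move=> B []. Qed.

Lemma band_gen_band h : is_band (band_gen h).
Proof.
split.
- split=> [B [[[]]]//|t x y hx hy B Bh].
  by have [[[_ lin] _ _] _] := Bh; apply: lin; [apply: hx|apply: hy].
- move=> x y hy xy B Bh; have [[_ sol _] _] := Bh.
  by apply: sol xy; apply: hy.
move=> I le f l dir hf fl B Bh; have [[_ _ clo] _] := Bh.
by apply: clo dir _ fl => i; apply: hf.
Qed.

(** The elements disjoint from [x] form a band; once it contains [h] it contains the band generated
    by [h]. *)
Lemma band_gen_disjoint h x y :
  disjoint_elts x h -> band_gen h y -> disjoint_elts x y.
Proof.
move=> xh /(_ (disjoint_complement [set x])) hy; apply: disjoint_eltsC.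
apply: hy => //; split; first exact: disjoint_complement_band.
by move=> _ ->; apply: disjoint_eltsC.
Qed.

Lemma weak_order_unit_disjoint e x : weak_order_unit e -> disjoint_elts x e -> x = 0.
Proof.
move=> [_ eT] xe; apply: disjoint_self; apply: (band_gen_disjoint xe).
by rewrite eT.
Qed.

Lemma weak_order_unit_meet e x : weak_order_unit e -> 0 <= x -> x \wedge e = 0 -> x = 0.
Proof.
move=> e_unit x0 xe; apply: (weak_order_unit_disjoint e_unit).
by apply/disjoint_pos => //; case: e_unit.
Qed.

(** The positive part of [K (w \wedge e) - h] lies below multiples of [w] and below
    [rpos (K e - h)], which are disjoint. Hence [K (w \wedge e) <= h] for every [K]. The unit
    property is stated elementwise because it is also applied to the unit of the f-algebra and to
    its positive multiples. *)
Lemma unit_exhaust e h w : 0 <= e -> (forall x, 0 <= x -> x \wedge e = 0 -> x = 0) ->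
  0 <= h -> 0 <= w ->
  (forall K : nat, w \wedge rpos (K%:R *: e - h) = 0) -> w = 0.
Proof.
move=> e0 e_unit h0 w0 wK; apply: e_unit => //.
apply: le_anti; rewrite rmeet_ge0 // andbT; apply: (@riesz_archimedean _ h) => K.
have [le1 le2] := rmeet_lb w e; have K0 : 0 <= K%:R :> R by [].
have m0 : 0 <= w \wedge e by apply: rmeet_ge0.
have dis : (K%:R *: (w \wedge e)) \wedge rpos (K%:R *: e - h) = 0.
  rewrite rmeetC; apply: meet_eq0Z => //; rewrite rmeetC.
  exact: meet_eq0_le m0 _ le1 (lexx _) (wK K).
have h1 : K%:R *: (w \wedge e) - h <= 0; last by apply: (riesz_le_by h1); vring.
apply: rpos_le_meet0 dis.
  apply: rpos_lub; last exact: riesz_scale_ge0.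
  by apply: (riesz_le_by h0); vring.
apply: rposS; have h2 := riesz_lerZ _ _ _ K0 le2.
by apply: (riesz_le_by h2); vring.
Qed.

(** This expresses that [rpos (h - K e)] decreases to 0: it is disjoint from [rpos (K e - h)], and
    these elements exhaust the space as [K] grows. *)
Lemma le0_of_truncation e h x (t : R) : weak_order_unit e -> 0 <= h -> 0 <= t ->
  (forall K : nat, x <= t *: rpos (h - K%:R *: e)) -> x <= 0.
Proof.
move=> e_unit h0 t0 xK.
suff x0 : rpos x = 0 by rewrite -x0 rpos_ge.
have e0 : 0 <= e by case: e_unit.
apply: (unit_exhaust e0 _ h0) => // [x' x0|K]; first exact: weak_order_unit_meet.
apply: (@meet_eq0_le _ _ (t *: rpos (h - K%:R *: e)) (rpos (K%:R *: e - h))) => //.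
  by apply: rpos_lub => //; apply: riesz_scale_ge0.
rewrite rmeetC; apply: meet_eq0Z => //.
by rewrite -[h - _]opprB rpos_meet.
Qed.

(** The last clause is the classical formula for projections onto principal bands. It is what puts
    [P e] into the range of a conditional expectation whose range contains [h] and [e]. *)
Definition principal_projection h (P : {linear E -> E}) : Prop :=
  [/\ band_projection_onto (band_gen h) P,
      forall x, 0 <= x -> 0 <= P x <= x &
      forall x, 0 <= x -> supremums (range (fun n : nat => (n%:R *: h) \wedge x)) (P x)].

Section BandDecomposition.
Variables (B : set E) (P : E -> E).
Hypothesis BP : band_projection_onto B P.

(** The difference of two decompositions lies in the band and in its disjoint complement, so it is
    disjoint from itself. *)
Lemma band_projection_unique x y : B y -> disjoint_complement B (x - y) -> P x = y.
Proof.
case: BP => -[[B0 linB] _ _] dP By dxy; have [BPx dPx] := dP x.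
have [[_ lind] _ _] := disjoint_complement_band B.
apply/eqP; rewrite -subr_eq0; apply/eqP; apply: disjoint_self.
have Bz : B (P x - y).
  by have := linB (-1) _ _ By BPx; rewrite scaleN1r addrC.
suff dz : disjoint_complement B (P x - y) by apply: dz.
have := lind (-1) _ _ dPx dxy; congr (disjoint_complement B _); vring.
Qed.

Lemma band_projection_linear : linear P.
Proof.
case: BP => -[[B0 linB] _ _] dP t x y; apply: band_projection_unique.
  by apply: linB; apply: (dP _).1.
have [[_ lind] _ _] := disjoint_complement_band B.
have := lind t _ _ (dP x).2 (dP y).2; congr (disjoint_complement B _); vring.
Qed.

End BandDecomposition.

Lemma principal_projection_ex h : 0 <= h -> exists P, principal_projection h P.
Proof.
move=> h0; pose f x (n : nat) := (n%:R *: h) \wedge x.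
have [[band0 lin] sol clo] := band_gen_band h.
have [[_ lind] _ _] := disjoint_complement_band (band_gen h).
have nh0 (n : nat) : 0 <= n%:R *: h by apply: riesz_scale_ge0.
have /choice [p pP] : forall x, exists s, supremums (range (f x)) s.
  move=> x; apply: (@ded_sup _ x); first by exists (f x 0%N), 0%N.
  by move=> _ [n _ <-]; apply rmeet_lb.
have p_itv x : 0 <= x -> 0 <= p x <= x.
  case: (pP x) => pu pl x0; apply/andP; split; last first.
    by apply: pl => _ [n _ <-]; apply rmeet_lb.
  by apply: le_trans (pu (f x 0%N) _); [apply: rmeet_ge0|exists 0%N].
have p_band x : 0 <= x -> band_gen h (p x).
  move=> x0; apply: (clo _ _ (f x) _ nat_directed).
    move=> n; apply: (sol _ (n%:R *: h)).
      have := lin (n%:R) _ _ (@band_gen_self h) band0.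
      by rewrite addr0.
    by rewrite !rabs_id ?rmeet_ge0 //; apply rmeet_lb.
  apply: seq_ocvg_sup (pP x) => i j ij; apply: rmeetS => //.
  by apply: riesz_scale2 => //; rewrite ler_nat.
have p_disj x : 0 <= x -> disjoint_complement (band_gen h) (x - p x).
  move=> x0 y; apply: band_gen_disjoint; case: (pP x) => pu pl.
  have /andP[p0 px] := p_itv x x0; have q0 : 0 <= x - p x by apply/riesz_sub_ge0.
  apply/disjoint_pos => //; have [d1 d2] := rmeet_lb (x - p x) h.
  apply: le_anti; rewrite rmeet_ge0 // andbT.
  (* Adding [(x - p x) \wedge h] to [n h \wedge x] stays below [(n + 1) h \wedge x], hence below
     [p x]; taking suprema forces the added element to be at most 0. *)
  suff le_p : p x <= p x - ((x - p x) \wedge h) by apply: (riesz_le_by le_p); vring.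
  apply: pl => _ [n _ <-]; have [f1 f2] := rmeet_lb (n%:R *: h) x.
  have fp : f x n <= p x by apply: pu; exists n.
  suff le_p : f x n + ((x - p x) \wedge h) <= p x by apply: (riesz_le_by le_p); vring.
  apply: le_trans (pu (f x n.+1) _); last by exists n.+1.
  apply: rmeet_glb.
    by apply: (riesz_le_by (riesz_leD f1 d2)); rewrite -(@natr1 R n); vring.
  by apply: (riesz_le_by (riesz_leD fp d1)); vring.
(* The supremum formula is trusted on positive elements only. Linearity of the extension comes from
   uniqueness of the band decomposition, not from the formula. *)
pose q x := p (rpos x) - p (rpos (- x)).
have qP : band_projection_onto (band_gen h) q.
  split=> [|x]; first exact: band_gen_band.
  have := lin (-1) _ _ (p_band _ (rpos_ge0 (- x))) (p_band _ (rpos_ge0 x)).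
  rewrite scaleN1r addrC => Bq; split=> //.
  have := lind (-1) _ _ (p_disj _ (rpos_ge0 (- x))) (p_disj _ (rpos_ge0 x)).
  congr (disjoint_complement _ _); rewrite /q -[X in _ = X - (_ - _)]rpos_sub; vring.
have qp x : 0 <= x -> q x = p x.
  move=> x0; rewrite /q rpos_id // [rpos (- x)]rpos_eq0.
    have /andP[h1 h2] := p_itv 0 (lexx _).
    have -> : p 0 = 0 by apply: le_anti; rewrite h2.
    exact: subr0.
  by apply: (riesz_le_by x0); vring.
pose qL := GRing.isLinear.Build R E E _ q (band_projection_linear qP).
pose Q : {linear E -> E} := HB.pack q qL.
exists Q; split=> // x x0; first by rewrite /= qp // p_itv.
by rewrite /= qp //; apply: pP.
Qed.

Section PrincipalProjection.
Variables (h : E) (P : {linear E -> E}).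
Hypotheses (h0 : 0 <= h) (hP : principal_projection h P).

Lemma pproj_ge0 x : 0 <= x -> 0 <= P x.
Proof. by case: hP => _ itv _ /itv /andP[]. Qed.
Lemma pproj_le_id x : 0 <= x -> P x <= x.
Proof. by case: hP => _ itv _ /itv /andP[]. Qed.
Lemma pproj_le x y : x <= y -> P x <= P y.
Proof.
move=> /riesz_sub_ge0 xy; apply/riesz_sub_ge0; rewrite -linearB.
exact: pproj_ge0.
Qed.
Lemma pproj_compl_le x y : x <= y -> x - P x <= y - P y.
Proof.
move=> /riesz_sub_ge0 /pproj_le_id; rewrite linearB => le.
by apply: (riesz_le_by le); vring.
Qed.
Lemma pproj_band x : band_gen h x -> P x = x.
Proof.
case: hP => BP _ _ hx; apply: (band_projection_unique BP) => //.
by rewrite subrr; case: (disjoint_complement_band (band_gen h)) => -[].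
Qed.
Lemma pproj_self : P h = h.
Proof. exact: pproj_band (@band_gen_self h). Qed.
Lemma pproj_idem x : P (P x) = P x.
Proof. by apply: pproj_band; case: hP => -[_ /(_ x) []]. Qed.
Lemma pproj_disjoint x : 0 <= x -> x \wedge h = 0 -> P x = 0.
Proof.
case: hP => _ _ sP x0 xh; apply: le_anti; rewrite pproj_ge0 // andbT.
case: (sP x x0) => _; apply=> _ [n _ <-]; rewrite rmeetC.
by rewrite meet_eq0Z.
Qed.
Lemma pproj_fix t x e : 0 <= x -> x <= t *: P e -> P x = x.
Proof.
move=> x0 xe; apply: le_anti; rewrite pproj_le_id //=.
have := pproj_compl_le xe; rewrite linearZ pproj_idem subrr => le.
by apply: (riesz_le_by le); vring.
Qed.
Lemma pproj_kill t x e : 0 <= x -> x <= t *: (e - P e) -> P x = 0.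
Proof.
move=> x0 xe; apply: le_anti; rewrite pproj_ge0 // andbT.
by have := pproj_le xe; rewrite linearZ /= linearB pproj_idem subrr scaler0.
Qed.

End PrincipalProjection.

(** [2 P - id] acts as the sign of [u]. For fixed [P] the absolute value becomes a linear
    expression, so operators commuting with [P] can be moved through it. *)
Lemma pproj_abs u (P : {linear E -> E}) : principal_projection (rpos u) P ->
  P u = rpos u /\ rabs u = 2 *: P u - u.
Proof.
move=> uP; have Pu : P u = rpos u.
  rewrite -[u in LHS]rpos_sub linearB (pproj_self uP).
  by rewrite (pproj_disjoint _ uP) ?subr0 // rmeetC rpos_meet.
split=> //; rewrite Pu rabsE.
have h := rpos_sub u; rewrite -{4}h; vring.
Qed.

End DedekindComplete.

(** * Conditional expectations and martingale differences *)

Section DisjointSums.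
Context {R : realType} {E : rieszType R}.
Implicit Types x y z a b c e : E.

Lemma disjoint_add_le a b c : a \wedge b = 0 -> a <= c -> b <= c -> a + b <= c.
Proof.
move=> ab ac bc; suff h : a + b - c <= 0 by apply: (riesz_le_by h); vring.
rewrite -ab; apply: rmeet_glb.
  by apply: (riesz_le_by bc); vring.
by apply: (riesz_le_by ac); vring.
Qed.

(* The tents are centred at the multiples of [2 * C], so they are disjoint. *)
Lemma sum_tents_le e x (C : R) (N : nat) : 0 <= e -> 0 <= C ->
  \sum_(i < N) rpos (C *: e - rabs (x - (2 * C * i.+1%:R) *: e)) <= C *: e.
Proof.
move=> e0 C0; have Ce0 := riesz_scale_ge0 C0 e0.
have tent_le (u : E) : rpos (C *: e - rabs u) <= C *: e.
  by apply: rpos_lub => //; have h := rabs_ge0 u; apply: (riesz_le_by h); vring.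
(* The second bound places the first [N] tents on the side where [x] is below [(2 C N + C) e], the
   left foot of the next tent; this is the disjointness that the induction needs. *)
suff [] : \sum_(i < N) rpos (C *: e - rabs (x - (2 * C * i.+1%:R) *: e)) <= C *: e /\
    \sum_(i < N) rpos (C *: e - rabs (x - (2 * C * i.+1%:R) *: e)) <=
    N%:R *: rpos ((2 * C * N%:R + C) *: e - x) by [].
elim: N => [|N [IH1 IH2]].
  by rewrite !big_ord0 scale0r.
rewrite !big_ord_recr /=; set s := \sum_(i < N) _ in IH1 IH2 *.
set z := x - _; have s0 : 0 <= s by apply: riesz_sum_ge0.
split.
  apply: disjoint_add_le => //.
  apply: (@meet_eq0_le _ _ (N%:R *: rpos ((2 * C * N%:R + C) *: e - x))
    (rpos (x - (2 * C * N%:R + C) *: e))) => //.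
    apply: rposS; have h := rabs_geN z.
    apply: (riesz_le_by h); rewrite /z -(natr1 N); vring.
  rewrite rmeetC; apply: meet_eq0Z => //.
  by rewrite -[_ *: e - x]opprB rpos_meet.
set r := rpos ((2 * C * N.+1%:R + C) *: e - x).
rewrite -[X in X *: r](natr1 N) scalerDl scale1r; apply: riesz_leD.
  apply: le_trans IH2 _; apply: riesz_lerZ => //; apply: rposS.
  have h := riesz_scale2 (_ : 2 * C * N%:R + C <= 2 * C * N.+1%:R + C) e0.
  have {}h := h _; apply: (riesz_le_by (h _)); last by vring.
  by rewrite -(natr1 N); lra.
apply: rposS; have h := rabs_ge z.
by apply: (riesz_le_by h); rewrite /z -(natr1 N); vring.
Qed.

End DisjointSums.

Section ConditionalExpectation.
Context {R : realType} {E : rieszType R}.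
Hypothesis E_ded : dedekind_complete E.
Variables (e : E) (T : {linear E -> E}).
Hypotheses (e_unit : weak_order_unit e) (Te : T e = e).
Hypotheses (T_ce : cond_exp T) (T_strict : strictly_positive T).
Implicit Types (x y z h : E) (S U V P : {linear E -> E}) (C K : R).

Let e0 : 0 <= e. Proof. by case: e_unit. Qed.

Lemma ce_le S x y : cond_exp S -> x <= y -> S x <= S y.
Proof.
move=> S_ce /riesz_sub_ge0 xy; apply/riesz_sub_ge0; rewrite -linearB.
exact: cond_exp_pos.
Qed.

Lemma ce_abs S x : cond_exp S -> rabs (S x) <= S (rabs x).
Proof.
move=> S_ce; apply: rabs_lub; first by apply: ce_le (rabs_ge x).
by rewrite -linearN; apply: ce_le (rabs_geN x).
Qed.

Lemma ce_abs_le S x y : cond_exp S -> rabs x <= y -> rabs (S x) <= S y.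
Proof. by move=> S_ce xy; apply: le_trans (ce_abs _ _) (ce_le _ _). Qed.

Lemma ce_fix S x : cond_exp S -> range S x -> S x = x.
Proof. by move=> S_ce [y _ <-]; apply: cond_exp_idem. Qed.

Lemma range_fix S x : S x = x -> range S x. Proof. by move=> <-; exists x. Qed.

Lemma range_rpos S x : cond_exp S -> range S x -> range S (rpos x).
Proof.
move=> S_ce Sx; have [[S0 _] Sl] := cond_exp_range_riesz S_ce.
by have [] := Sl x 0 Sx S0.
Qed.

Lemma range_lin S (t : R) x y : range S x -> range S y -> range S (t *: x + y).
Proof. by move=> [u _ <-] [v _ <-]; exists (t *: u + v); rewrite // linearP. Qed.

Definition sub_ce S := cond_exp S /\ compatible T S.

Lemma sub_ce_e S : sub_ce S -> S e = e.
Proof. by case=> _ /(_ e) [h _]; rewrite -Te h Te. Qed.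

Lemma range_sub_e S t x : sub_ce S -> range S x -> range S (x - t *: e).
Proof.
move=> Ss Sx; have := range_lin (- t) (range_fix (sub_ce_e Ss)) Sx.
by rewrite scaleNr addrC.
Qed.

Lemma proj_range S h P : cond_exp S -> range S e -> range S h -> 0 <= h ->
  principal_projection h P -> range S (P e).
Proof.
move=> S_ce Se Sh h0 [_ _ sP].
apply: (range_cond_exp_sup S_ce _ _ (sP e e0)) => [n|i j ij].
  have [[S0 Sl] Sm] := cond_exp_range_riesz S_ce.
  have := Sl n%:R _ _ Sh S0; rewrite addr0 => Snh.
  by have [] := Sm _ _ Snh Se.
by apply: rmeetS => //; apply: riesz_scale2 => //; rewrite ler_nat.
Qed.

(** [P e] is fixed by [S]. For [y] between 0 and [K e], the element [S (P y)] is at most [K P e] and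
    so is fixed by [P], while [S (y - P y)] is at most [K (e - P e)] and so is annihilated by
    [P]. *)
Lemma proj_commute S h P K x : sub_ce S -> range S h -> 0 <= h ->
  principal_projection h P -> rabs x <= K *: e -> S (P x) = P (S x).
Proof.
move=> Ss Sh h0 hP; have [S_ce _] := Ss; have Se := range_fix (sub_ce_e Ss).
have SPe : S (P e) = P e by apply: ce_fix => //; apply: (proj_range S_ce Se Sh).
have pos y : 0 <= y -> y <= K *: e -> S (P y) = P (S y).
  move=> y0 yK.
  have h1 : P (S (P y)) = S (P y).
    apply: (pproj_fix (t := K) (e := e) hP).
      by apply: cond_exp_pos => //; apply: (pproj_ge0 hP).
    have := ce_le S_ce (pproj_le hP yK).
    by rewrite !linearZ /= SPe.
  have h2 : P (S (y - P y)) = 0.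
    apply: (pproj_kill (t := K) (e := e) hP).
      apply: cond_exp_pos => //; apply/riesz_sub_ge0; exact: (pproj_le_id hP).
    have := ce_le S_ce (pproj_compl_le hP yK).
    have -> : K *: e - P (K *: e) = K *: (e - P e) by rewrite linearZ /=; vring.
    by rewrite linearZ /= [S (e - _)]linearB /= SPe (sub_ce_e Ss).
  by move: h2; rewrite !linearB /= h1 => /eqP; rewrite subr_eq0 => /eqP.
move=> xK; rewrite -(rpos_sub x) !linearB /= !pos //.
  exact: le_trans (rneg_le_abs x) xK.
exact: le_trans (rpos_le_abs x) xK.
Qed.

Lemma proj_T_commute S h P K x : sub_ce S -> range S h -> 0 <= h ->
  principal_projection h P -> rabs x <= K *: e -> T (P (S x)) = T (P x).
Proof.
move=> Ss Sh h0 hP xK; rewrite -(proj_commute Ss Sh h0 hP xK).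
by case: Ss => _ /(_ (P x)) [].
Qed.

Lemma ce_bounded S K x : sub_ce S -> rabs x <= K *: e -> rabs (S x) <= K *: e.
Proof.
move=> Ss xK; have := ce_abs_le (proj1 Ss) xK.
by rewrite linearZ /= sub_ce_e.
Qed.

(** The projection onto the band of [rpos (x - y)] is itself one of the tests; it gives
    [T (rpos (x - y)) = 0]. *)
Lemma le_of_proj S x y : cond_exp S -> range S (x - y) ->
  (forall h P, 0 <= h -> range S h -> principal_projection h P ->
     T (P x) = T (P y)) -> x <= y.
Proof.
move=> S_ce Sxy TP; suff : rpos (x - y) = 0.
  move=> h; have := rpos_ge (x - y); rewrite h => le.
  by apply: (riesz_le_by le); vring.
have [P hP] := principal_projection_ex E_ded (rpos_ge0 (x - y)).
apply: T_strict => //; have [<- _] := pproj_abs hP.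
rewrite !linearB /= (TP _ _ _ _ hP) ?subrr //.
exact: range_rpos.
Qed.

(** Both sides lie in the range of [S] and agree under [T] after every principal projection coming
    from that range; such a projection commutes with [U] as well because the ranges are nested. *)
Lemma ce_tower S U K x : sub_ce S -> sub_ce U -> range S `<=` range U ->
  rabs x <= K *: e -> S (U x) = S x.
Proof.
move=> Ss Us SU xK; have [S_ce _] := Ss; have UK := ce_bounded Us xK.
have test h P : 0 <= h -> range S h -> principal_projection h P ->
    T (P (S (U x))) = T (P (S x)).
  move=> h0 Sh hP; rewrite !(proj_T_commute Ss Sh h0 hP (K := K)) //.
  by rewrite (proj_T_commute Us (SU _ Sh) h0 hP xK).
apply: le_anti; apply/andP; split; apply: (@le_of_proj S) => //.
- by rewrite -linearB; exists (U x - x).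
- by rewrite -linearB; exists (x - U x).
by move=> h P h0 Sh hP; rewrite (test h P).
Qed.

(* [2 *: P y - y] is the sign of [x] times [y]; the tent corrects the steps that
   may cross the kink of the absolute value. *)
Lemma abs_add_le x y C P : principal_projection (rpos x) P -> rabs y <= C *: e ->
  rabs (x + y) <= rabs x + (2 *: P y - y) + 2 *: rpos (C *: e - rabs x).
Proof.
move=> xP yC; have [Px _] := pproj_abs xP; set tent := rpos (_ - rabs x).
have absE := rabsE x; have xE := rpos_sub x.
have Pneg : P (rpos (- x)) = 0.
  have := congr1 P xE; rewrite linearB /= Px (pproj_self xP) => /eqP.
  by rewrite subr_eq addrC -subr_eq subrr => /eqP.
have Ce_le : C *: e <= tent + rabs x.
  by have h := rpos_ge (C *: e - rabs x); apply: (riesz_le_by h); vring.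
have [yl yu] := rabs_le_itv yC.
(* The bound [tent + rabs x] for [y] and [- y] reduces to [tent + rpos (- x)] off the band of
   [rpos x] and to [tent + rpos x] on it. Twice these estimates are what the two branches of the
   absolute value require. *)
have h1 : y - P y <= tent + rpos (- x).
  apply: le_trans (pproj_compl_le xP (le_trans yu Ce_le)) _.
  rewrite !linearD /= absE linearD /= (pproj_self xP) Pneg.
  have h := pproj_ge0 xP (rpos_ge0 (C *: e - rabs x)).
  by apply: (riesz_le_by h); rewrite /tent absE; vring.
have h2 : - P y <= tent + rpos x.
  have h : - y <= tent + rabs x.
    by apply: le_trans (rabs_geN y) (le_trans yC Ce_le).
  have := pproj_le xP h; rewrite linearN => /le_trans; apply.
  rewrite linearD /= absE linearD /= (pproj_self xP) Pneg addr0.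
  by apply: riesz_leD => //; apply: (pproj_le_id xP); apply: rpos_ge0.
have h20 : 0 <= 2 :> R by [].
apply: rabs_lub.
  apply: (riesz_le_by (riesz_lerZ _ _ _ h20 h1)).
  by rewrite absE -[X in X + y]xE; vring.
apply: (riesz_le_by (riesz_lerZ _ _ _ h20 h2)).
by rewrite absE -[X in X + y]xE; vring.
Qed.

(** The sign of each [x - t e] comes from the range of [S], so the linear terms vanish under [T]
    because [S y = 0]. What remains is twice a sum of disjoint tents, whence an increment
    independent of [N]. *)
Lemma martingale_step S x y C (N : nat) : sub_ce S -> range S x -> S y = 0 ->
  rabs y <= C *: e -> 0 <= C ->
  T (\sum_(i < N) rabs (x + y - (2 * C * i.+1%:R) *: e)) <=
  T (\sum_(i < N) rabs (x - (2 * C * i.+1%:R) *: e)) + (2 * C) *: e.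
Proof.
move=> Ss Sx Sy yC C0; have h := ce_le T_ce (sum_tents_le x N e0 C0).
have {}h := riesz_lerZ 2 _ _ (ler0n _ _) h; rewrite linearZ /= Te scalerA in h.
apply: le_trans (riesz_leD (lexx _) h).
rewrite !linear_sum -big_split /=; apply: riesz_sum_le => i _.
set z := x - _; have Sz : range S z by apply: range_sub_e.
have -> : x + y - (2 * C * i.+1%:R) *: e = z + y by rewrite /z; vring.
have [P zP] := principal_projection_ex E_ded (rpos_ge0 z).
have := ce_le T_ce (abs_add_le zP yC).
have -> : T (rabs z + (2 *: P y - y) + 2 *: rpos (C *: e - rabs z)) =
          T (rabs z) + 2 *: T (rpos (C *: e - rabs z)).
  have TPy : T (P y) = 0.
    rewrite -(proj_T_commute Ss (range_rpos (proj1 Ss) Sz) (rpos_ge0 z) zP yC).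
    by rewrite Sy !linear0.
  have Ty : T y = 0.
    by case: Ss => _ /(_ y) [_ <-]; rewrite Sy linear0.
  by rewrite !linearD /= linearN !linearZ /= TPy Ty; vring.
by [].
Qed.

(** One [2 C N] comes from phi at 0, the other from comparing [N |M|] with phi; the [m] increments
    of [2 C] are divided by [N]. For [m >= N^2] the bound divided by [m] is at most [6 C / N]. *)
Lemma martingale_mean_bound (Sg : nat -> {linear E -> E}) (Y : nat -> E) C (m N : nat) :
  0 <= C -> (0 < N)%N -> (forall k, sub_ce (Sg k)) ->
  (forall k, range (Sg k) `<=` range (Sg k.+1)) ->
  (forall k, rabs (Y k) <= C *: e) -> (forall k, range (Sg k.+1) (Y k)) ->
  (forall k, Sg k (Y k) = 0) ->
  T (rabs (\sum_(k < m) Y k)) <= (4 * C * N%:R + 2 * C * m%:R / N%:R) *: e.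
Proof.
move=> C0 N0 Ss mono YC YS SY0.
have M_range : forall j, range (Sg j) (\sum_(k < j) Y k).
  elim=> [|j IHj]; first by rewrite big_ord0; exists 0 => //; rewrite linear0.
  rewrite big_ord_recr /= -[X in X + _]scale1r.
  exact: range_lin (mono _ _ IHj) (YS j).
set M := \sum_(k < m) Y k.
pose phi x := \sum_(i < N) rabs (x - (2 * C * i.+1%:R) *: e).
have ti (i : 'I_N) : 0 <= 2 * C * i.+1%:R <= 2 * C * N%:R.
  rewrite mulr_ge0 ?mulr_ge0 //=; apply: ler_wpM2l; first exact: mulr_ge0.
  by rewrite ler_nat.
have N_gt0 : 0 < N%:R :> R by rewrite ltr0n.
have phi0 : phi 0 <= (2 * C * N%:R * N%:R) *: e.
  have -> : (2 * C * N%:R * N%:R) *: e = \sum_(i < N) (2 * C * N%:R) *: e.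
    by rewrite sumr_const card_ord -scaler_nat; vring.
  apply: riesz_sum_le => i _; have /andP[ti0 tiN] := ti i.
  by rewrite sub0r rabsN rabs_id ?riesz_scale_ge0 // riesz_scale2.
have phiM : T (phi M) <= (2 * C * N%:R * N%:R + 2 * C * m%:R) *: e.
  rewrite /M; elim: m {M} => [|j IHj].
    rewrite big_ord0 mulr0 addr0; have := ce_le T_ce phi0.
    by rewrite linearZ /= Te.
  rewrite big_ord_recr /=.
  apply: le_trans (martingale_step N (Ss j) (M_range j) (SY0 j) (YC j) C0) _.
  by apply: (riesz_le_by IHj); rewrite -(natr1 j); vring.
have NM : N%:R *: rabs M <= phi M + (2 * C * N%:R * N%:R) *: e.
  have -> : N%:R *: rabs M = \sum_(i < N) rabs M.
    by rewrite sumr_const card_ord scaler_nat.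
  have -> : (2 * C * N%:R * N%:R) *: e = \sum_(i < N) (2 * C * N%:R) *: e.
    by rewrite sumr_const card_ord -scaler_nat; vring.
  rewrite -big_split; apply: riesz_sum_le => i _ /=.
  have /andP[ti0 tiN] := ti i; set t := 2 * C * i.+1%:R in ti0 tiN *.
  have {1}-> : M = (M - t *: e) + t *: e by vring.
  apply: le_trans (rabsD _ _) _; apply: riesz_leD => //.
  by rewrite rabs_id ?riesz_scale_ge0 // riesz_scale2.
have := ce_le T_ce NM; rewrite linearD !linearZ /= Te => TM.
apply: (riesz_le_unscale N_gt0).
have N_neq0 : N%:R != 0 :> R by rewrite gt_eqF.
by apply: (riesz_le_by (riesz_leD TM phiM)); vfield.
Qed.

End ConditionalExpectation.

(** * f-algebra multiplication *)

Section FAlgebra.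
Context {R : realType} {F : rieszType R}.
Hypothesis F_ded : dedekind_complete F.
Variables (mul : F -> F -> F) (u : F).
Hypothesis mulP : falgebra_mul mul u.
Hypothesis u0 : 0 <= u.
Implicit Types x y z s t w h : F.

Let mulLe : forall x, exists L : {linear F -> F}, forall y, L y = mul x y.
Proof.
move=> x; have lin : linear (mul x) by move=> t y z; exact: (falg_linr mulP).
pose fL := GRing.isLinear.Build R F F _ (mul x) lin.
by pose L : {linear F -> F} := HB.pack (mul x) fL; exists L.
Qed.
Let mulRe : forall y, exists L : {linear F -> F}, forall x, L x = mul x y.
Proof.
move=> y; have lin : linear (mul ^~ y) by move=> t x z; exact: (falg_linl mulP).
pose fL := GRing.isLinear.Build R F F _ (mul ^~ y) lin.
by pose L : {linear F -> F} := HB.pack (mul ^~ y) fL; exists L.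
Qed.

Lemma falg_mul1l x : mul u x = x. Proof. by have [] := falg_mul1 mulP x. Qed.
Lemma falg_mul1r x : mul x u = x. Proof. by have [] := falg_mul1 mulP x. Qed.
Lemma falg_mulrD x y z : mul x (y + z) = mul x y + mul x z.
Proof. by have [L LE] := mulLe x; rewrite -!LE linearD. Qed.
Lemma falg_mulrB x y z : mul x (y - z) = mul x y - mul x z.
Proof. by have [L LE] := mulLe x; rewrite -!LE linearB. Qed.
Lemma falg_mulrZ (a : R) x y : mul x (a *: y) = a *: mul x y.
Proof. by have [L LE] := mulLe x; rewrite -!LE linearZ. Qed.
Lemma falg_mulr_sum x I (r : seq I) (P : pred I) (f : I -> F) :
  mul x (\sum_(i <- r | P i) f i) = \sum_(i <- r | P i) mul x (f i).
Proof.
have [L LE] := mulLe x; rewrite -LE linear_sum.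
by apply: eq_bigr => i _; rewrite LE.
Qed.
Lemma falg_mulDl x y z : mul (x + y) z = mul x z + mul y z.
Proof. by have [L LE] := mulRe z; rewrite -!LE linearD. Qed.
Lemma falg_mulBl x y z : mul (x - y) z = mul x z - mul y z.
Proof. by have [L LE] := mulRe z; rewrite -!LE linearB. Qed.
Lemma falg_mulZl (a : R) x y : mul (a *: x) y = a *: mul x y.
Proof. by have [L LE] := mulRe y; rewrite -!LE linearZ. Qed.

Lemma falg_le_mull x y z : 0 <= x -> y <= z -> mul x y <= mul x z.
Proof.
move=> x0 /riesz_sub_ge0 yz; apply/riesz_sub_ge0; rewrite -falg_mulrB.
exact: falg_pos mulP _ _ x0 yz.
Qed.
Lemma falg_le_mulr x y z : 0 <= z -> x <= y -> mul x z <= mul y z.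
Proof.
move=> z0 /riesz_sub_ge0 xy; apply/riesz_sub_ge0; rewrite -falg_mulBl.
exact: falg_pos mulP _ _ xy z0.
Qed.

(** Multiplying first one and then the other side of [x \wedge y = 0] makes [mul x y] disjoint from
    itself. *)
Lemma falg_mul_disjoint x y : 0 <= x -> 0 <= y -> x \wedge y = 0 -> mul x y = 0.
Proof.
move=> x0 y0 xy; have [h1 _] := falg_disj mulP xy y0.
rewrite rmeetC in h1; have [_ h2] := falg_disj mulP h1 x0.
by rewrite -h2 rmeet_idl.
Qed.

Lemma falg_sq x : mul x x = mul (rpos x) (rpos x) + mul (rpos (- x)) (rpos (- x)).
Proof.
have xE := rpos_sub x; have m0 := rpos_meet x.
rewrite -{1 2}xE falg_mulBl !falg_mulrB (falg_mul_disjoint _ _ m0) //.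
by rewrite [mul (rpos (- x)) (rpos x)]falg_mul_disjoint 1?rmeetC //; vring.
Qed.

Lemma falg_sq_ge0 x : 0 <= mul x x.
Proof. by rewrite falg_sq; apply: riesz_addr_ge0; apply: (falg_pos mulP). Qed.

Lemma falg_sq_le x y : 0 <= x -> x <= y -> mul x x <= mul y y.
Proof.
move=> x0 xy; apply: le_trans (falg_le_mull x0 xy) _.
exact: falg_le_mulr (le_trans x0 xy) xy.
Qed.

Lemma falg_sq_sub_unit x (c : R) :
  mul (x - c *: u) (x - c *: u) = mul x x - (2 * c) *: x + (c ^+ 2) *: u.
Proof.
rewrite falg_mulBl !falg_mulrB !falg_mulrZ !falg_mulZl ?falg_mulrZ.
by rewrite ?falg_mul1l !falg_mul1r; vring.
Qed.

Lemma falg_unit_meet x : 0 <= x -> x \wedge u = 0 -> x = 0.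
Proof.
rewrite rmeetC => x0 ux; have [h _] := falg_disj mulP ux x0.
by move: h; rewrite falg_mul1l rmeet_idl.
Qed.

(** This is order continuity of multiplication by [h]. Since [h <= K u + rpos (h - K u)], the
    product is at most [K v m] up to a term disjoint from [rpos (K u - h)], and these last elements
    exhaust the space. *)
Lemma falg_null_product h w (v : nat -> F) : 0 <= h -> 0 <= w ->
  infimums (range v) 0 -> (forall m, w <= mul h (v m)) -> w = 0.
Proof.
move=> h0 w0 v0 wv; apply: (unit_exhaust F_ded u0 falg_unit_meet h0 w0) => K.
apply: le_anti; rewrite rmeet_ge0 // andbT.
apply: (le0_of_null v0 (ler0n R K)) => m.
have vm0 : 0 <= v m by apply v0; exists m.
set y := rpos (_ - h); set q := mul (rpos (h - K%:R *: u)) (v m).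
have q0 : 0 <= q by apply: (falg_pos mulP).
have Kv0 : 0 <= K%:R *: v m by apply: riesz_scale_ge0.
have yq : y \wedge q = 0.
  have hy : rpos (h - K%:R *: u) \wedge y = 0.
    by rewrite /y -[_ *: u - h]opprB rpos_meet.
  by rewrite rmeetC; have [] := falg_disj mulP hy vm0.
have wle : w <= K%:R *: v m + q.
  apply: le_trans (wv m) _; set k := K%:R *: u + rpos (h - K%:R *: u).
    apply: le_trans (falg_le_mulr vm0 (y := k) _) _.
    by rewrite /k; have le := rpos_ge (h - K%:R *: u); apply: (riesz_le_by le); vring.
  by rewrite /k falg_mulDl falg_mulZl falg_mul1l.
rewrite rmeetC; apply: le_trans (rmeetS (lexx y) wle) _.
apply: le_trans (rmeetDr_le _ Kv0 q0) _ => //; first exact: rpos_ge0.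
by rewrite yq addr0; apply rmeet_lb.
Qed.

(* The tangent lines of the square bound [t^2] by [s^2]; without multiplying by [t],
   [(t - s)^+] is shown to vanish on the slabs where [K d u <= s < (K + 1) d u]. *)
Lemma falg_root_le s t : 0 <= s ->
  (forall c : R, 0 < c -> (2 * c) *: t <= (c ^+ 2) *: u + mul s s) -> t <= s.
Proof.
move=> s0 tc; set w := rpos (t - s).
suff w0 : w <= 0 by apply: (riesz_le_by (le_trans (rpos_ge _) w0)); vring.
(* The square [(s - c u)^2] dominates [2 c (t - s)] by the tangent inequality and is positive, so it
   dominates the positive part too. *)
have wc c : 0 < c -> (2 * c) *: w <= mul (s - c *: u) (s - c *: u).
  move=> c0; have c20 : 0 < 2 * c by rewrite mulr_gt0.
  apply: (@riesz_le_unscale _ _ (2 * c)^-1); first by rewrite invr_gt0.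
  rewrite scalerA mulVf ?gt_eqF // scale1r; apply: rpos_lub; last first.
    by apply: riesz_scale_ge0 (falg_sq_ge0 _); rewrite invr_ge0 ltW.
  apply: (@riesz_le_unscale _ _ (2 * c)) => //.
  rewrite scalerA mulfV ?gt_eqF // scale1r falg_sq_sub_unit.
  by apply: (riesz_le_by (tc c c0)); vring.
apply: (riesz_archimedean_eps F_ded u0) => d d0.
suff w'0 : rpos (w - d *: u) = 0.
  by have le := rpos_ge (w - d *: u); rewrite w'0 in le; apply: (riesz_le_by le); vring.
set w' := rpos (w - d *: u).
have du0 : 0 <= d *: u by apply: riesz_scale_ge0 => //; apply: ltW.
have w0 : 0 <= w by apply: rpos_ge0.
have w'0 : 0 <= w' by apply: rpos_ge0.
apply: (unit_exhaust F_ded du0 _ s0) => // [x x0 xd|K].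
  apply: falg_unit_meet => //; have := meet_eq0Z x0 du0 (_ : 0 <= d^-1) xd.
  by rewrite scalerA mulVf ?gt_eqF // scale1r; apply; rewrite invr_ge0 ltW.
elim: K => [|K IHK].
  rewrite scale0r sub0r rpos_eq0; last by apply: (riesz_le_by s0); vring.
  by rewrite rmeetC rmeet_idl // rpos_ge0.
pose c := K.+1%:R * d.
have c0 : 0 < c by rewrite mulr_gt0 // ltr0Sn.
have dc : d <= c by rewrite /c ler_peMl ?ler1n //; apply: ltW.
have cE : c = K%:R * d + d by rewrite /c -natr1; ring.
rewrite scalerA -/c; set X := c *: u - s; set z := w' \wedge _.
have [zw zX] := rmeet_lb w' (rpos X); rewrite -/z in zw zX.
have z0 : 0 <= z by apply: rmeet_ge0; apply: rpos_ge0.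
have zXn : z \wedge rpos (- X) = 0 by apply: meet_eq0_le (rpos_meet X).
set q := rpos (K%:R *: (d *: u) - s) in IHK.
have q0 : 0 <= q by apply: rpos_ge0.
have zq : z \wedge q = 0 by apply: meet_eq0_le IHK.
have Xq : rpos X <= q + d *: u.
  apply: rpos_lub; last exact: riesz_addr_ge0.
  have le := rpos_ge (K%:R *: (d *: u) - s); apply: (riesz_le_by le).
  by rewrite /X cE /q; vring.
(* [r] collects the terms living outside the slab: [q] below it and [rpos (- X)] above it. Inside,
   the square is at most [d^2 u], so [w] is at most [d^2 / (2 c)] times [u], which is below [d u]
   because [d <= c]. *)
pose r := (2 * d) *: q + mul q q + mul (rpos (- X)) (rpos (- X)).
have zr : z \wedge r = 0.
  have d20 : 0 <= 2 * d by rewrite mulr_ge0 // ltW.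
  apply: meet_eq0D => //; first apply: riesz_addr_ge0.
  - exact: riesz_scale_ge0.
  - exact: falg_sq_ge0.
  - exact: falg_sq_ge0.
  - apply: meet_eq0D => //; first exact: riesz_scale_ge0.
    + exact: falg_sq_ge0.
    + exact: meet_eq0Z.
    + by rewrite rmeetC; rewrite rmeetC in zq; have [] := falg_disj mulP zq q0.
  rewrite rmeetC; rewrite rmeetC in zXn.
  by have [] := falg_disj mulP zXn (rpos_ge0 (- X)).
have r0 : 0 <= r.
  by do 2?apply: riesz_addr_ge0; rewrite ?falg_sq_ge0 // riesz_scale_ge0 // mulr_ge0 // ltW.
have le1 : (2 * c) *: w <= (d ^+ 2) *: u + r.
  apply: le_trans (wc c c0) _.
  have -> : s - c *: u = - X by rewrite /X; vring.
  rewrite falg_sq opprK addrC.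
  have le := falg_sq_le (rpos_ge0 X) Xq; apply: (riesz_le_by le).
  rewrite falg_mulDl !falg_mulrD !falg_mulrZ !falg_mulZl ?falg_mulrZ.
  by rewrite ?falg_mul1l !falg_mul1r /r; vring.
have c20 : 0 < (2 * c)^-1 by rewrite invr_gt0 mulr_gt0.
have le2 : w' <= (2 * c)^-1 *: r.
  apply: rpos_lub; last by apply: riesz_scale_ge0 => //; apply: ltW.
  have h := riesz_lerZ _ _ _ (ltW c20) le1.
  rewrite scalerA mulVf ?gt_eqF ?mulr_gt0 // scale1r in h.
  have h2 : (2 * c)^-1 * d ^+ 2 <= d.
    rewrite mulrC ler_pdivrMr ?mulr_gt0 // expr2 ler_pM2l //.
    by rewrite -[d]mul1r ler_pM // ?ler1n // ltW.
  by apply: (riesz_le_by (riesz_leD h (riesz_scale2 h2 u0))); vring.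
have := meet_eq0Z z0 r0 (ltW c20) zr; rewrite rmeet_idl //.
exact: le_trans zw le2.
Qed.

End FAlgebra.

(** * Universal completion and uniform order convergence *)

Section UniversalCompletion.
Context {R : realType} {E Eu : rieszType R} (iota : {linear E -> Eu}).
Hypothesis iota_uc : universal_completion iota.
Implicit Types (x y : E).

Lemma embed_le x y : iota x <= iota y <-> x <= y.
Proof.
case: iota_uc => -[inj _ im] _ _; split=> [xy|/rmeet_idl <-].
  by rewrite -(inj _ _ (etrans (im x y) (rmeet_idl xy))); apply rmeet_lb.
by rewrite im; apply rmeet_lb.
Qed.

Lemma embed_ge0 x : 0 <= iota x <-> 0 <= x.
Proof. by rewrite -(embed_le 0) linear0. Qed.

Lemma completion_ded : dedekind_complete Eu.
Proof. by case: iota_uc => _ []. Qed.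

(** By order density, a nonzero positive lower bound in [Eu] would dominate a nonzero positive
    element of [E]. *)
Lemma embed_null (v : nat -> E) : infimums (range v) 0 ->
  infimums (range (iota \o v)) 0.
Proof.
move=> [v0 vl]; split=> [_ [m _ <-]|x xv]; first by apply/embed_ge0/v0; exists m.
case: iota_uc => _ _ dense; apply: le_trans (rpos_ge x) _.
case: (eqVneq (rpos x) 0) => [-> //|xn0].
have [] := dense (rpos x); first by rewrite lt_neqAle eq_sym xn0 rpos_ge0.
move=> y [y0 yx]; suff : y <= 0.
  by move/embed_le; rewrite linear0 => /(lt_le_trans y0); rewrite ltxx.
apply: vl => _ [m _ <-]; apply/embed_le; apply: le_trans yx _.
apply: rpos_lub; first by apply: xv; exists m.
by apply/embed_ge0/v0; exists m.
Qed.

(** If [iota s - z] had a nonzero positive part, order density would give some [y > 0] below it, and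
    [s - y] would still bound [A]. *)
Lemma embed_sup_le (A : set E) s (z : Eu) : supremums A s ->
  (forall x, A x -> iota x <= z) -> iota s <= z.
Proof.
move=> [As sA] Az; case: iota_uc => _ _ dense.
suff h : rpos (iota s - z) = 0.
  by have := rpos_ge (iota s - z); rewrite h => le; apply: (riesz_le_by le); vring.
apply/eqP; apply: contraT => n0.
have [|y [y0 yx]] := dense (rpos (iota s - z)).
  by rewrite lt_neqAle eq_sym n0 rpos_ge0.
have h : s <= s - y.
  apply: sA => x Ax; apply/embed_le; rewrite linearB /=.
  suff le : rpos (iota s - z) <= iota s - iota x.
    by apply: (riesz_le_by (le_trans yx le)); vring.
  apply: rpos_lub; first by have le := Az x Ax; apply: (riesz_le_by le); vring.
  by apply/riesz_sub_ge0/embed_le/As.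
have {}h : y <= 0 by apply: (riesz_le_by h); vring.
by move/embed_le: h; rewrite linear0 => /(lt_le_trans y0); rewrite ltxx.
Qed.

End UniversalCompletion.

Section UniformConvergence.
Context {R : realType} {E Eu : rieszType R} (iota : {linear E -> Eu}).
Hypotheses (E_ded : dedekind_complete E) (iota_uc : universal_completion iota).
Implicit Types (w H : E) (z : Eu) (a : int -> nat -> E).

(* [w] stands for the superior limit of [a n m] as [m] grows; its upper bounds
   may be taken in [Eu]. *)
Lemma ocvg0_uniformly_limsup a H :
  (forall n m, (0 < m)%N -> 0 <= a n m <= H) ->
  (forall w, 0 <= w ->
    (forall M z, (forall n m, (M <= m)%N -> (0 < m)%N -> iota (a n m) <= z) ->
      iota w <= z) ->
    w <= 0) ->
  ocvg0_uniformly a.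
Proof.
move=> aH crit.
pose W M := [set x : E | exists n m, [/\ (M <= m)%N, (0 < m)%N & x = a n m]].
have W0 M : W M (a 0 M.+1) by exists 0, M.+1.
have /choice [u uP] : forall M, exists s, supremums (W M) s.
  move=> M; apply: (@ded_sup _ _ E_ded _ H); first by exists (a 0 M.+1).
  by move=> _ [n [m [_ m0 ->]]]; case/andP: (aH n m m0).
have u0 M : 0 <= u M.
  by case: (uP M) => + _ => /(_ _ (W0 M)); apply: le_trans; case/andP: (aH 0 M.+1 isT).
exists u; split=> // [|n m m0]; last by apply: (uP m).1; exists n, m.
(* Suprema over tails decrease, so [u] serves as its own dominating sequence. *)
exists u; split.
- move=> i j ij; apply: (uP j).2 => _ [n [m [jm m0 ->]]]; apply: (uP i).1.
  by exists n, m; split=> //; apply: leq_trans jm.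
- split=> [_ [m _ <-] //|w wu]; apply: le_trans (rpos_ge w) _; apply: crit => //.
  move=> M z az; apply: (@le_trans _ _ (iota (u M))).
    by apply/(embed_le iota_uc); apply: rpos_lub => //; apply: wu; exists M.
  by apply: (embed_sup_le iota_uc (uP M)) => _ [n [m [jm m0 ->]]]; apply: az.
by exists 0%N => i _; rewrite subr0 rabs_id.
Qed.

Lemma ocvg0_uniformly_dominated a : ocvg0_uniformly a ->
  exists v M, [/\ forall i j, (i <= j)%N -> v j <= v i, infimums (range v) 0 &
    forall n m, (M <= m)%N -> (0 < m)%N -> a n m <= v m].
Proof.
move=> [u [_ [v [va v0 [M uv]]] au]]; exists v, M; split=> // n m Mm m0.
apply: le_trans (au n m m0) _; apply: le_trans (rabs_ge _) _.
by have := uv m Mm; rewrite subr0.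
Qed.

End UniformConvergence.

(** * Approximation by components of the unit *)

Section LayerCake.
Context {R : realType} {E : rieszType R}.
Hypothesis E_ded : dedekind_complete E.
Variable e : E.
Hypothesis e0 : 0 <= e.

(** The slice [c k] of [x] between levels [k d] and [(k + 1) d] lies between [d Q_(k+1) e] and
    [d Q_k e]. The sums of these bounds telescope up to [d (Q_0 e - Q_N e)], at most [d e]. *)
Lemma layer_cake (x : E) (d : R) (N : nat) : 0 < d -> 0 <= x -> x <= (N%:R * d) *: e ->
  exists Q : nat -> {linear E -> E},
    (forall k, principal_projection (rpos (x - (k%:R * d) *: e)) (Q k)) /\
    0 <= x - \sum_(i < N) d *: Q i.+1 e <= d *: e.
Proof.
move=> d0 x0 xN; pose lev k := rpos (x - (k%:R * d) *: e).
have /choice [Q QP] : forall k, exists P : {linear E -> E}, principal_projection (lev k) P.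
  by move=> k; apply: principal_projection_ex E_ded _ (rpos_ge0 _).
exists Q; split=> //.
pose c k := lev k - lev k.+1.
have xE : x = \sum_(i < N) c i.
  have -> : \sum_(i < N) c i = lev 0%N - lev N.
    elim: N {xN} => [|N IH]; first by rewrite big_ord0 subrr.
    by rewrite big_ord_recr /= IH /c; vring.
  rewrite /lev mul0r scale0r subr0 rpos_id // rpos_eq0 ?subr0 //.
  by apply: (riesz_le_by xN); vring.
have de0 : 0 <= d *: e by apply: riesz_scale_ge0 => //; apply: ltW.
have levS k : x - (k%:R * d) *: e = (x - (k.+1%:R * d) *: e) + d *: e.
  by rewrite -natr1; vring.
have c0 k : 0 <= c k.
  by apply/riesz_sub_ge0; apply: rposS; apply: (riesz_le_by de0); rewrite -natr1; vring.
have cd k : c k <= d *: e.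
  suff h : lev k <= lev k.+1 + d *: e by apply: (riesz_le_by h); rewrite /c; vring.
  rewrite /lev levS; apply: rpos_lub; last exact: riesz_addr_ge0.
  by apply: riesz_leD => //; apply: rpos_ge.
have up k : c k <= d *: Q k e.
  have ck : c k <= lev k.
    have h := rpos_ge0 (x - (k.+1%:R * d) *: e).
    by apply: (riesz_le_by h); rewrite /c /lev; vring.
  have := pproj_compl_le (QP k) ck; rewrite (pproj_self (QP k)) subrr => h1.
  have := pproj_le (QP k) (cd k); rewrite linearZ /= => h2.
  by apply: (riesz_le_by (riesz_leD h1 h2)); vring.
have dn k : d *: Q k.+1 e <= c k.
  (* Where [x] exceeds level [k + 1] the slice is full: [d e - c k] is disjoint from [lev k.+1] and
     is annihilated by [Q k.+1]. *)
  have h0 : 0 <= d *: e - c k by apply/riesz_sub_ge0.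
  have hd : (d *: e - c k) \wedge lev k.+1 = 0.
    rewrite rmeetC; apply: (meet_eq0_le _ h0 (lexx _) _ (rpos_meet _)) => //.
    have hs := rpos_sub (x - (k.+1%:R * d) *: e).
    have h := rpos_ge (x - (k%:R * d) *: e).
    rewrite -/(lev k) levS -{1}hs -/(lev k.+1) in h.
    by apply: (riesz_le_by h); rewrite /c; vring.
  have := pproj_disjoint (rpos_ge0 _) (QP k.+1) h0 hd; rewrite linearB linearZ /= => hQ.
  have h1 := pproj_le_id (QP k.+1) (c0 k).
  by apply: (riesz_le_by h1); rewrite -[LHS]addr0 -hQ; vring.
have sN : \sum_(i < N) d *: Q i e <= d *: e + \sum_(i < N) d *: Q i.+1 e.
  case: N {xN xE} => [|N]; first by rewrite !big_ord0 addr0.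
  rewrite big_ord_recl [X in _ <= _ + X]big_ord_recr /=; apply: riesz_leD.
    by apply: riesz_lerZ (pproj_le_id (QP _) e0); apply: ltW.
  have h : 0 <= d *: Q N.+1 e.
    by apply: riesz_scale_ge0; [apply: ltW|apply: (pproj_ge0 (QP _))].
  by apply: (riesz_le_by h); rewrite /bump /=; vring.
have upN : x <= \sum_(i < N) d *: Q i e by rewrite xE; apply: riesz_sum_le.
have dnN : \sum_(i < N) d *: Q i.+1 e <= x by rewrite xE; apply: riesz_sum_le.
apply/andP; split; first exact/riesz_sub_ge0.
by apply: (riesz_le_by (le_trans upN sN)); vring.
Qed.

End LayerCake.

(** * Mixing *)

Section MixingBounds.
Context {R : realType} {E : rieszType R}.
Hypothesis E_ded : dedekind_complete E.
Variables (e : E) (T : {linear E -> E}).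
Hypotheses (e_unit : weak_order_unit e) (Te : T e = e) (T_ce : cond_exp T).
Implicit Types (x y z h r : E) (S U V P Q : {linear E -> E}) (K : R).

Let e0 : 0 <= e. Proof. by case: e_unit. Qed.

Lemma sub_ce_T S x : sub_ce T S -> T (S x) = T x.
Proof. by case=> _ /(_ x) []. Qed.

Lemma event_projection_principal S h P : sub_ce T S -> range S h -> 0 <= h ->
  principal_projection h P -> event_projections e S P.
Proof.
move=> Ss Sh h0 hP; have [S_ce _] := Ss; split.
  by exists (band_gen h); case: hP.
by apply: (proj_range e_unit S_ce _ Sh h0 hP); apply: range_fix (sub_ce_e Te Ss).
Qed.

(** The shift by [K e] makes [z] positive and at most [2 K e], a range covered by [N] slices of
    thickness [2 K / N]. *)
Lemma simple_approximation V z K (N : nat) : sub_ce T V -> range V z ->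
  rabs z <= K *: e -> 0 < K -> (0 < N)%N ->
  exists Q : nat -> {linear E -> E},
    (forall k, event_projections e V (Q k) /\ 0 <= Q k e <= e) /\
    0 <= z + K *: e - \sum_(i < N) (2 * K / N%:R) *: Q i e <= (2 * K / N%:R) *: e.
Proof.
move=> Vs Vz zK K0 N0; have N_gt0 : 0 < N%:R :> R by rewrite ltr0n.
have [zl zu] := rabs_le_itv zK; have d0 : 0 < 2 * K / N%:R by rewrite divr_gt0 // mulr_gt0.
have [||Q [QP QE]] := layer_cake E_ded e0 (x := z + K *: e) (N := N) d0.
- by apply: (riesz_le_by zl); vring.
- have -> : N%:R * (2 * K / N%:R) = 2 * K by field; rewrite gt_eqF.
  by apply: (riesz_le_by zu); vring.
exists (fun k => Q k.+1); split=> // k; split; last first.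
  by rewrite (pproj_ge0 (QP _)) // (pproj_le_id (QP _)).
apply: (event_projection_principal Vs _ _ (QP k.+1)) => //.
apply: range_rpos; first by case: Vs.
apply: (range_sub_e Te) => //; rewrite addrC; apply: range_lin => //.
exact: range_fix (sub_ce_e Te Vs).
Qed.

Section Alpha.
Context {Eu : rieszType R} {iota : {linear E -> Eu}} {mul : Eu -> Eu -> Eu}.
Hypotheses (iota_uc : universal_completion iota) (mulP : falgebra_mul mul (iota e)).

(** With [P] the projection for [rpos (U z)], [T (rabs (U z))] is [2 T (P z) - T z]. Replacing each
    [T (P (Q_i e))] by a product costs [2 K a] in total. The products resum to at most [r + K p],
    whose [K p] cancels the shift of [z]. Doubling and adding [r] for [T z] gives [4 K] and 3. *)
Lemma alpha_mean_bound U V (a : Eu) z K r : sub_ce T U -> sub_ce T V ->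
  (forall P Q : E -> E, event_projections e U P -> event_projections e V Q ->
    rabs (iota (T (P (Q e))) - mul (iota (T (P e))) (iota (T (Q e)))) <= a) ->
  range V z -> rabs z <= K *: e -> 0 < K -> rabs (T z) <= r ->
  iota (T (rabs (U z))) <= (4 * K) *: a + 3 *: iota r.
Proof.
move=> Us Vs aP Vz zK K0 zr; have [U_ce _] := Us; have [V_ce _] := Vs.
have r0 : 0 <= r by apply: le_trans zr.
have ie0 : 0 <= iota e by apply/(embed_ge0 iota_uc).
have Uuz : range U (rpos (U z)) by apply: range_rpos => //; exists z.
have [P uP] := principal_projection_ex E_ded (rpos_ge0 (U z)).
have UP : event_projections e U P by apply: event_projection_principal uP.
have TUz : T (rabs (U z)) <= 2 *: T (P z) + r.
  have [_ ->] := pproj_abs uP; rewrite linearB linearZ /=.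
  rewrite (proj_T_commute e_unit Te Us Uuz _ uP zK) // (sub_ce_T _ Us).
  by have h := le_trans (rabs_geN _) zr; apply: (riesz_le_by h); vring.
have Pe0 := pproj_ge0 uP e0; have Pele := pproj_le_id uP e0.
set p := iota (T (P e)) in aP; have p0 : 0 <= p.
  by apply/(embed_ge0 iota_uc); apply: cond_exp_pos.
have pe : p <= iota e by apply/(embed_le iota_uc); rewrite -[X in _ <= X]Te; apply: ce_le.
have key (N : nat) : (0 < N)%N ->
    iota (T (P z)) <= iota r + (2 * K) *: a + (2 * K / N%:R) *: iota e.
  move=> N0; have [Q [QV QE]] := simple_approximation Vs Vz zK K0 N0.
  have N_neq0 : N%:R != 0 :> R by rewrite pnatr_eq0 -lt0n.
  move: QE; set d := 2 * K / N%:R; set s := \sum_(i < N) _ => /andP[s1 s2].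
  have d0 : 0 <= d by rewrite divr_ge0 ?mulr_ge0 // ltW.
  have TPx : iota (T (P (z + K *: e))) <= iota (T (P s)) + d *: iota e.
    have h : T (P (z + K *: e - s)) <= d *: e.
      have := ce_le T_ce (le_trans (pproj_le_id uP s1) s2).
      by rewrite [T (d *: e)]linearZ /= Te.
    have /(embed_le iota_uc) := h; rewrite !linearB linearZ /= => h2.
    by apply: (riesz_le_by h2); vring.
  have TPs : iota (T (P s)) <= mul p (iota (T s)) + (N%:R * d) *: a.
    rewrite /s !linear_sum /= (falg_mulr_sum mulP).
    have -> : (N%:R * d) *: a = \sum_(i < N) d *: a.
      by rewrite sumr_const card_ord -scaler_nat; vring.
    rewrite -big_split; apply: riesz_sum_le => i _ /=.
    rewrite !linearZ /= (falg_mulrZ mulP) -scalerDr; apply: riesz_lerZ => //.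
    have h := le_trans (rabs_ge _) (aP _ _ UP (proj1 (QV i))).
    by apply: (riesz_le_by h); rewrite -/p; vring.
  have Ts : mul p (iota (T s)) <= iota r + K *: p.
    apply: (@le_trans _ _ (mul p (iota r + K *: iota e))).
      apply: (falg_le_mull mulP) => //; rewrite -linearZ -linearD; apply/(embed_le iota_uc).
      apply: (@le_trans _ _ (T (z + K *: e))).
        by apply: ce_le => //; apply: (riesz_le_by s1); vring.
      rewrite linearD linearZ /= Te; apply: riesz_leD => //.
      exact: le_trans (rabs_ge _) zr.
    rewrite (falg_mulrD mulP) (falg_mulrZ mulP) (falg_mul1r mulP).
    apply: riesz_leD => //; rewrite -[X in _ <= X](falg_mul1l mulP).
    by apply: (falg_le_mulr mulP) => //; apply/(embed_ge0 iota_uc).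
  have NdE : N%:R * d = 2 * K by rewrite /d; field.
  rewrite NdE in TPs; move: TPx; rewrite !linearD !linearZ /= -/p => TPx.
  by apply: (riesz_le_by (riesz_leD TPx (riesz_leD TPs Ts))); vring.
suff h : iota (T (rabs (U z))) - ((4 * K) *: a + 3 *: iota r) <= 0.
  by apply: (riesz_le_by h); vring.
apply: (@riesz_archimedean _ _ (completion_ded iota_uc) _ ((4 * K) *: iota e)) => N.
case: N => [|N].
  by rewrite scale0r; apply: riesz_scale_ge0 => //; rewrite mulr_ge0 // ltW.
have /(embed_le iota_uc) := TUz; rewrite linearD linearZ /= => h1.
have h2 := riesz_lerZ 2 _ _ (ler0n _ _) (key N.+1 isT).
have h := riesz_lerZ N.+1%:R _ _ (ler0n _ _) (riesz_leD h1 h2).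
apply: (riesz_le_by h); have N_neq0 : N.+1%:R != 0 :> R by rewrite pnatr_eq0.
by move: (N.+1%:R) N_neq0 => t t0; vfield.
Qed.

End Alpha.

(** [U - T] annihilates the shift [K e], so [U z - T z] is [U - T] applied to the simple
    approximation plus an error of at most [2 d e]. The [N] weights [d = 2 K / N] add up to the
    factor [2 K], and the error vanishes as [N] grows. *)
Lemma phi_mean_bound U V (a : E) z K r : sub_ce T U -> sub_ce T V ->
  (forall Q : E -> E, event_projections e V Q -> 0 <= Q e <= e ->
    T (rabs (U (Q e) - T (Q e))) <= a) ->
  range V z -> rabs z <= K *: e -> 0 < K -> rabs (T z) <= r ->
  T (rabs (U z)) <= (2 * K) *: a + r.
Proof.
move=> Us Vs aP Vz zK K0 zr; have [U_ce _] := Us.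
have Tabs : T (rabs (T z)) = rabs (T z).
  apply: ce_fix => //; rewrite rabsE -[rpos (T z)]scale1r.
  have Tz : range T (T z) by exists z.
  apply: range_lin; apply: range_rpos => //.
  by exists (- z) => //; rewrite linearN.
suff h : T (rabs (U z)) - ((2 * K) *: a + r) <= 0.
  by apply: (riesz_le_by h); vring.
apply: (@riesz_archimedean _ _ E_ded _ ((4 * K) *: e)) => -[|N].
  by rewrite scale0r; apply: riesz_scale_ge0 => //; rewrite mulr_ge0 // ltW.
have [Q [QV QE]] := simple_approximation Vs Vz zK K0 (ltn0Sn N).
have N_neq0 : N.+1%:R != 0 :> R by rewrite pnatr_eq0.
move: QE; set d := 2 * K / N.+1%:R; set s := \sum_(i < N.+1) _ => /andP[s1 s2].
have d0 : 0 <= d by rewrite divr_ge0 ?mulr_ge0 // ltW.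
set v := z + K *: e - s in s1 s2.
have Ue := sub_ce_e Te Us.
have Uz : U z = T z + (\sum_(i < N.+1) d *: (U (Q i e) - T (Q i e)) + (U v - T v)).
  have -> : \sum_(i < N.+1) d *: (U (Q i e) - T (Q i e)) = U s - T s.
    rewrite /s [U _]linear_sum [T (\sum_(i < _) _)]linear_sum -sumrB.
    apply: eq_bigr => i _ /=.
    by rewrite !linearZ /=; vring.
  by rewrite /v !linearB !linearD !linearZ /= Ue Te; vring.
have vd S : cond_exp S -> S e = e -> rabs (S v) <= d *: e.
  by move=> S_ce Se; rewrite -Se -linearZ; apply: ce_abs_le => //; rewrite rabs_id.
have : rabs (U z) <= rabs (T z) + (\sum_(i < N.+1) d *: rabs (U (Q i e) - T (Q i e)) +
    (d *: e + d *: e)).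
  rewrite Uz; apply: le_trans (rabsD _ _) _; apply: riesz_leD => //.
  apply: le_trans (rabsD _ _) _; apply: riesz_leD.
    apply: le_trans (rabs_sum_le _ _ _) _; apply: riesz_sum_le => i _.
    by rewrite rabsZ.
  by apply: le_trans (rabsB _ _) _; apply: riesz_leD; apply: vd.
move=> /(ce_le T_ce); rewrite !linearD linear_sum !linearZ /= Tabs Te => h1.
have h2 : \sum_(i < N.+1) T (d *: rabs (U (Q i e) - T (Q i e))) <= (N.+1%:R * d) *: a.
  have -> : (N.+1%:R * d) *: a = \sum_(i < N.+1) d *: a.
    by rewrite sumr_const card_ord -scaler_nat; vring.
  apply: riesz_sum_le => i _; rewrite linearZ; have [h2 h3] := QV i.
  by apply: riesz_lerZ => //; apply: aP.
have h := riesz_lerZ N.+1%:R _ _ (ler0n _ _) (riesz_leD (riesz_leD h1 h2) zr).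
apply: (riesz_le_by h); rewrite /d; move: (N.+1%:R) N_neq0 => t t0.
by vfield.
Qed.

End MixingBounds.

(** * Truncation and domination *)

Section Truncation.
Context {R : realType} {E : rieszType R}.
Implicit Types x y c : E.

Definition rtrunc c x : E := (x \wedge c) \vee (- c).

Lemma rtrunc_abs c x : 0 <= c -> rabs (rtrunc c x) <= c.
Proof.
move=> c0; have [h1 h2] := rmeet_lb x c; have [h3 h4] := rjoin_ub (x \wedge c) (- c).
apply: rabs_lub; last by apply: (riesz_le_by h4); rewrite /rtrunc; vring.
by apply: rjoin_lub => //; apply: (riesz_le_by (riesz_leD c0 c0)); vring.
Qed.

Lemma rtrunc_close c x y : rabs x <= y -> rabs (x - rtrunc c x) <= rpos (y - c).
Proof.
move=> xy; have h0 := rpos_ge0 (y - c); have h := rpos_ge (y - c).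
have [xl xu] := rabs_le_itv xy; have [h3 h4] := rjoin_ub (x \wedge c) (- c).
apply: rabs_lub.
  suff le : x - rpos (y - c) <= x \wedge c.
    by apply: (riesz_le_by (le_trans le h3)); rewrite /rtrunc; vring.
  apply: rmeet_glb; first by apply: (riesz_le_by h0); vring.
  by apply: (riesz_le_by (riesz_leD h xu)); vring.
suff le : rtrunc c x <= x + rpos (y - c) by apply: (riesz_le_by le); vring.
apply: rjoin_lub; last by apply: (riesz_le_by (riesz_leD h xl)); vring.
apply: (@le_trans _ _ x); first by apply rmeet_lb.
by apply: (riesz_le_by h0); vring.
Qed.

End Truncation.

Section Domination.
Context {R : realType} {E : rieszType R}.
Hypothesis E_ded : dedekind_complete E.
Variables (e : E) (T : {linear E -> E}).
Hypotheses (e_unit : weak_order_unit e) (Te : T e = e) (T_ce : cond_exp T).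

Let e0 : 0 <= e. Proof. by case: e_unit. Qed.

Lemma range_rtrunc (S : {linear E -> E}) (K : R) x : sub_ce T S -> range S x ->
  range S (rtrunc (K *: e) x).
Proof.
move=> Ss Sx; have [S_ce _] := Ss; have Se := range_fix (sub_ce_e Te Ss).
have [[S0 Sl] Sm] := cond_exp_range_riesz S_ce.
have Ke t : range S (t *: e) by have := Sl t _ _ Se S0; rewrite addr0.
by rewrite /rtrunc -scaleNr; apply Sm => //; apply Sm.
Qed.

(** At a fixed level [c], the part of [rabs (f n)] in the band where it exceeds [c e] contributes at
    most [u c], and the rest is at most [c e]. The maximum with 0 guards against a negative [c0]. *)
Lemma T_uniform_bounded (f : int -> E) : T_uniform T e f ->
  exists H, forall n, T (rabs (f n)) <= H.
Proof.
move=> [c0 [u [uP _]]]; pose c := Num.max c0 0.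
have c0c : c0 <= c by rewrite le_max lexx.
have [uc _] := uP c c0c.
exists (u c + c *: e) => n; set x := rabs (f n).
have [P hP] := principal_projection_ex E_ded (rpos_ge0 (x - c *: e)).
have x0 : 0 <= x by apply: rabs_ge0.
have TPx : T (P x) <= u c by apply: uc; exists n, P; split=> //; case: hP.
have q0 : 0 <= x - P x by apply/riesz_sub_ge0; apply: (pproj_le_id hP).
have dis : (x - P x) \wedge rpos (x - c *: e) = 0.
  apply/disjoint_pos => //; have [[_ dP] _ _] := hP.
  by apply: (dP x).2; apply: band_gen_self.
have qc : x - P x <= c *: e.
  have c_ge0 : 0 <= c by rewrite le_max lexx orbT.
  have Px0 : 0 <= P x by apply: (pproj_ge0 hP).
  suff h : x - P x - c *: e <= 0 by apply: (riesz_le_by h); vring.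
  apply: rpos_le_meet0 dis.
    apply: rpos_lub => //; have h := riesz_scale_ge0 c_ge0 e0.
    by apply: (riesz_le_by h); vring.
  by apply: rposS; apply: (riesz_le_by Px0); vring.
have := ce_le T_ce qc; rewrite linearB linearZ /= Te => h.
by apply: (riesz_le_by (riesz_leD TPx h)); vring.
Qed.

Context {Eu : rieszType R} {iota : {linear E -> Eu}} {mul : Eu -> Eu -> Eu}.
Hypotheses (iota_uc : universal_completion iota) (mulP : falgebra_mul mul (iota e)).

Let ie0 : 0 <= iota e. Proof. exact/(embed_ge0 iota_uc). Qed.

(** For [p_two], [T] is applied to the linear inequalities [2 c |x| <= c^2 e + |x|^2], one for each
    [c], and the square root is recovered afterwards. For [p_infty], every admissible [g] satisfies
    [T (rabs x) <= T g = g]. *)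
Lemma L1_le_Lp_norm p x s : is_Lp_norm iota mul T p x s -> T (rabs x) <= s.
Proof.
case: p => /= [-> //|[s0 [h hx sT]]|[_ sl]]; last first.
  by apply: sl => g [[Tg g0] xg]; rewrite -(ce_fix T_ce Tg); apply: ce_le.
apply/(embed_le iota_uc).
apply: (falg_root_le (completion_ded iota_uc) mulP ie0) => [|c c0].
  exact/(embed_ge0 iota_uc).
have le : (2 * c) *: rabs x <= (c ^+ 2) *: e + h.
  apply/(embed_le iota_uc); rewrite linearD !linearZ /= hx.
  have := falg_sq_ge0 mulP (iota (rabs x) - c *: iota e).
  by rewrite (falg_sq_sub_unit mulP) => le; apply: (riesz_le_by le); vring.
have := ce_le T_ce le; rewrite linearD !linearZ /= Te => /(embed_le iota_uc).
by rewrite linearD !linearZ /= sT.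
Qed.

Section Mixing.
Variables Tpast Tfut : int -> {linear E -> E}.
Hypotheses (past_ce : forall n, sub_ce T (Tpast n)) (fut_ce : forall n, sub_ce T (Tfut n)).

(** [is_phi] bounds the norms that exist. The bound [0 <= Q e <= e] puts [2 e] among the admissible
    dominating elements, so the infimum defining the norm exists. *)
Lemma phi_norm_bound n k a (Q : E -> E) :
  is_phi iota mul T e (Tpast n) (Tfut k) a -> event_projections e (Tfut k) Q ->
  0 <= Q e <= e -> T (rabs (Tpast n (Q e) - T (Q e))) <= a.
Proof.
move=> [aub _] QV /andP[Q0 Q1]; set x := _ - _.
have Qe1 : rabs (Q e) <= 1 *: e by rewrite rabs_id // scale1r.
have x2 : rabs x <= 2 *: e.
  have h1 := ce_bounded Te (past_ce n) Qe1.
  have h2 := ce_abs_le T_ce Qe1; rewrite linearZ /= Te in h2.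
  by apply: le_trans (rabsB _ _) _; apply: (riesz_le_by (riesz_leD h1 h2)); vring.
have [s sP] : exists s, is_Lp_norm iota mul T p_infty x s.
  apply: (@ded_inf _ _ E_ded _ 0); last by move=> g [[_ g0] _].
  exists (2 *: e); split=> //; split; last exact: riesz_scale_ge0.
  by exists (2 *: e) => //; rewrite linearZ /= Te.
by apply: le_trans (L1_le_Lp_norm sP) _; apply: aub; exists Q.
Qed.

(** Both kinds of mixing are put into one form in [Eu] with the larger, alpha constants; the phi
    bounds are embedded and remain null. *)
Lemma mixing_mean_bound :
  alpha_mixing iota mul T e Tpast Tfut \/ phi_mixing iota mul T e Tpast Tfut ->
  exists (v : nat -> Eu) (M : nat),
    [/\ forall i j, (i <= j)%N -> v j <= v i, infimums (range v) 0 &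
      forall n m z (K : R) r, (M <= m)%N -> (0 < m)%N -> range (Tfut (n + m%:Z)) z ->
        rabs z <= K *: e -> 0 < K -> rabs (T z) <= r ->
        iota (T (rabs (Tpast n z))) <= (4 * K) *: v m + 3 *: iota r].
Proof.
case=> [[a [am [aP amP [v [va v0 [M aM]]]]]]|[a [am [aP amP [v [va v0 [M aM]]]]]]].
  exists v, M; split=> // n m z K r Mm m0 zV zK K0 zr.
  apply: (alpha_mean_bound E_ded e_unit Te T_ce iota_uc mulP
    (past_ce n) (fut_ce _) _ zV zK K0 zr).
  move=> P Q PU QV; have [aub _] := aP n m m0; have [amub _] := amP m m0.
  apply: le_trans (aub _ _) _; first by exists P, Q.
  apply: le_trans (amub _ _) _; first by exists n.
  by apply: le_trans (rabs_ge _) _; have := aM m Mm; rewrite subr0.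
exists (iota \o v), M.
split=> [i j /va /(embed_le iota_uc) //||n m z K r Mm m0 zV zK K0 zr].
  exact: embed_null.
have r0 : 0 <= r by apply: le_trans zr.
have vm0 : 0 <= v m by apply v0; exists m.
have le : T (rabs (Tpast n z)) <= (2 * K) *: v m + r.
  apply: (phi_mean_bound E_ded e_unit Te T_ce (past_ce n) (fut_ce _) _ zV zK K0 zr).
  move=> Q QV Q01; have [amub _] := amP m m0.
  apply: le_trans (phi_norm_bound (aP n m m0) QV Q01) _.
  apply: le_trans (amub _ _) _; first by exists n.
  by apply: le_trans (rabs_ge _) _; have := aM m Mm; rewrite subr0.
have {}le : T (rabs (Tpast n z)) <= (4 * K) *: v m + 3 *: r.
  have h1 : 0 <= (2 * K) *: v m by apply: riesz_scale_ge0 => //; rewrite mulr_ge0 // ltW.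
  have h2 : 0 <= 2 *: r by apply: riesz_scale_ge0.
  by apply: (riesz_le_by (riesz_leD le (riesz_leD h1 h2))); vring.
by move/(embed_le iota_uc): le; rewrite linearD !linearZ.
Qed.

End Mixing.
End Domination.

Section RieszClosure.
Context {R : realType} {E : rieszType R}.

Lemma sub_riesz_closure (A : set E) : A `<=` riesz_closure A.
Proof. by move=> x Ax F [_ _]; apply. Qed.

Lemma riesz_closure_mono (A B : set E) : A `<=` B -> riesz_closure A `<=` riesz_closure B.
Proof. by move=> AB x Ax F [F1 F2 BF]; apply: Ax; split=> // y /AB /BF. Qed.

End RieszClosure.

(** * Averages of near-epoch dependent sequences *)

Section Mixingales.
Context {R : realType} {E : rieszType R}.
Hypothesis E_ded : dedekind_complete E.
Variables (e : E) (T : {linear E -> E}).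
Hypotheses (e_unit : weak_order_unit e) (Te : T e = e) (T_ce : cond_exp T).
Hypothesis T_strict : strictly_positive T.
Variable S : int -> {linear E -> E}.
Hypotheses (S_ce : forall n, sub_ce T (S n)).
Hypothesis S_mono : forall n, range (S n) `<=` range (S (n + 1)).

Let e0 : 0 <= e. Proof. by case: e_unit. Qed.

Lemma sub_ce_refl : sub_ce T T.
Proof. by split=> // x; rewrite (cond_exp_idem T_ce). Qed.

Lemma T_abs_ce U x : sub_ce T U -> T (rabs (U x)) <= T (rabs x).
Proof.
move=> Us; rewrite -[X in _ <= X](sub_ce_T _ Us); apply: ce_le => //.
by apply: ce_abs; case: Us.
Qed.

(** Truncating costs one [r], and undoing it in the two ends of the telescope costs three more. The
    [3 M] levels run from [i - 2 M] to [i + M]. Each difference of truncated expectations is bounded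
    by [2 K e], the constant [C] of the martingale estimate. *)
Lemma mixingale_mean_bound (f : int -> E) (G A B : E) (M N m K : nat) (n : int) :
  (forall i, rabs (f i) <= G) -> range T G -> (0 < N)%N -> (0 < m)%N ->
  (forall i, T (rabs (f i - S (i + M%:Z) (f i))) <= A) ->
  (forall i, T (rabs (S (i - M%:Z - M%:Z) (f i))) <= B) ->
  T (rabs (block_mean f n m)) <= A + B + 4 *: rpos (G - K%:R *: e) +
    ((3 * M)%:R * (8 * K%:R * N%:R / m%:R + 4 * K%:R / N%:R)) *: e.
Proof.
move=> fG TG N0 m0 fA fB; set r := rpos _.
pose f' i := rtrunc (K%:R *: e) (f i).
have Ke0 : 0 <= K%:R *: e by apply: riesz_scale_ge0.
have Tr : T r = r.
  by apply: ce_fix => //; apply: range_rpos => //; apply: (range_sub_e Te) sub_ce_refl TG.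
have f'K i : rabs (f' i) <= K%:R *: e by apply: rtrunc_abs.
have ff' i : T (rabs (f i - f' i)) <= r.
  by rewrite -Tr; apply: ce_le => //; apply: rtrunc_close.
pose base i : int := i - M%:Z - M%:Z.
have topE i : base i + (3 * M)%:Z = i + M%:Z by rewrite /base; lia.
pose Y (j : nat) i := S (base i + j.+1%:Z) (f' i) - S (base i + j%:Z) (f' i).
pose rest i := (f i - f' i) + (f' i - S (i + M%:Z) (f' i)) + S (base i) (f' i).
have split_f i : f i = rest i + \sum_(j < 3 * M) Y j i.
  have -> : \sum_(j < 3 * M) Y j i = S (i + M%:Z) (f' i) - S (base i) (f' i).
    rewrite -topE; elim: (3 * M)%N => [|k IHk].
      by rewrite big_ord0 addr0 subrr.
    by rewrite big_ord_recr /= IHk /Y; vring.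
  by rewrite /rest; vring.
have T_rest i : T (rabs (rest i)) <= A + B + 4 *: r.
  have h1 := ff' i; have h2 := fA i; have h3 := fB i.
  have close U : sub_ce T U -> T (rabs (U (f i - f' i))) <= r.
    by move=> Us; apply: le_trans (T_abs_ce _ Us) h1.
  have h4 := close _ (S_ce (i + M%:Z)); have h5 := close _ (S_ce (base i)).
  have le : rabs (rest i) <= rabs (f i - f' i) + rabs (f i - f' i) +
      rabs (f i - S (i + M%:Z) (f i)) + rabs (S (i + M%:Z) (f i - f' i)) +
      rabs (S (base i) (f i)) + rabs (S (base i) (f i - f' i)).
    have -> : rest i = (f i - f' i) - (f i - f' i) + (f i - S (i + M%:Z) (f i)) +
        S (i + M%:Z) (f i - f' i) + S (base i) (f i) - S (base i) (f i - f' i).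
      rewrite /rest [S (i + M%:Z) (f i - _)]linearB [S (base i) (f i - _)]linearB /=.
      by vring.
    apply: le_trans (rabsB _ _) _; apply: riesz_leD => //.
    do 3![apply: le_trans (rabsD _ _) _; apply: riesz_leD => //].
    exact: rabsB.
  have := ce_le T_ce le; rewrite ![T (_ + _)]linearD /= => {}le.
  have h := riesz_leD (riesz_leD (riesz_leD h1 h1) (riesz_leD h2 h4)) (riesz_leD h3 h5).
  by apply: (riesz_le_by (riesz_leD le h)); vring.
pose idx (k : nat) : int := n + k.+1%:Z.
have T_mart j : T (rabs (\sum_(k < m) Y j (idx k))) <=
    (8 * K%:R * N%:R + 4 * K%:R * m%:R / N%:R) *: e.
  (* For fixed [j] the level moves up by one with the index, so the terms [Y j (idx k)] are
     martingale differences in [k]. *)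
  pose Sg (k : nat) := S (base (idx k) + j%:Z).
  have SgS k : Sg k.+1 = S (base (idx k) + j%:Z + 1).
    by rewrite /Sg; congr S; rewrite /base /idx; lia.
  have jS i : base i + j.+1%:Z = base i + j%:Z + 1 by lia.
  have K20 : 0 <= 2 * K%:R :> R by apply: mulr_ge0.
  have := martingale_mean_bound E_ded e_unit Te T_ce (Sg := Sg)
    (Y := fun k => Y j (idx k)) m K20 N0.
  have -> : 4 * (2 * K%:R) * N%:R + 2 * (2 * K%:R) * m%:R / N%:R =
            8 * K%:R * N%:R + 4 * K%:R * m%:R / N%:R :> R.
    by field; rewrite pnatr_eq0 -lt0n.
  apply=> k.
  - exact: S_ce.
  - by rewrite SgS; apply: S_mono.
  - have h1 := ce_bounded Te (S_ce (base (idx k) + j.+1%:Z)) (f'K (idx k)).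
    have h2 := ce_bounded Te (S_ce (base (idx k) + j%:Z)) (f'K (idx k)).
    by apply: le_trans (rabsB _ _) _; apply: (riesz_le_by (riesz_leD h1 h2)); vring.
  - have -> : Y j (idx k) = -1 *: S (base (idx k) + j%:Z) (f' (idx k)) +
        S (base (idx k) + j%:Z + 1) (f' (idx k)) by rewrite /Y jS; vring.
    rewrite SgS; apply: range_lin; last by exists (f' (idx k)).
    by apply: S_mono; exists (f' (idx k)).
  rewrite /Y /Sg jS linearB /=.
  (* The truncation supplies the multiple of [e] that the tower property asks for. *)
  rewrite (ce_tower E_ded e_unit Te T_strict (S_ce _) (S_ce _) _ (f'K (idx k))).
    by rewrite (cond_exp_idem (proj1 (S_ce _))) subrr.
  exact: S_mono.
have sum_le : rabs (\sum_(k < m) f (idx k)) <=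
    \sum_(k < m) rabs (rest (idx k)) + \sum_(j < 3 * M) rabs (\sum_(k < m) Y j (idx k)).
  have -> : \sum_(k < m) f (idx k) =
      \sum_(k < m) rest (idx k) + \sum_(j < 3 * M) \sum_(k < m) Y j (idx k).
    by rewrite exchange_big -big_split; apply: eq_bigr => k _; apply: split_f.
  by apply: le_trans (rabsD _ _) _; apply: riesz_leD; apply: rabs_sum_le.
have m_gt0 : 0 < m%:R :> R by rewrite ltr0n.
have blockE : block_mean f n m = m%:R^-1 *: \sum_(k < m) f (idx k).
  by rewrite /block_mean big_add1 /= big_mkord.
have := ce_le T_ce sum_le; rewrite linearD !linear_sum /= => {}sum_le.
have h1 : \sum_(k < m) T (rabs (rest (idx k))) <= m%:R *: (A + B + 4 *: r).
  rewrite scaler_nat -[in X in _ <= X](card_ord m) -sumr_const.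
  by apply: riesz_sum_le => k _; apply: T_rest.
have h2 : \sum_(j < 3 * M) T (rabs (\sum_(k < m) Y j (idx k))) <=
    (3 * M)%:R *: ((8 * K%:R * N%:R + 4 * K%:R * m%:R / N%:R) *: e).
  rewrite [(3 * M)%:R *: _]scaler_nat -[in X in _ <= X](card_ord (3 * M)) -sumr_const.
  by apply: riesz_sum_le => j _; apply: T_mart.
rewrite blockE rabsZ ?invr_ge0 // linearZ /=; apply: (riesz_le_unscale m_gt0).
rewrite scalerA mulfV ?gt_eqF // scale1r.
apply: (riesz_le_by (riesz_leD sum_le (riesz_leD h1 h2))).
have mn : m%:R != 0 :> R by rewrite gt_eqF.
have Nn : N%:R != 0 :> R by rewrite pnatr_eq0 -lt0n.
move: (3 * M)%N => M3; move: (m%:R) (N%:R) mn Nn => t s t0 s0.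
by vfield; rewrite t0 s0.
Qed.

End Mixingales.

Section NearEpochDependence.
Context {R : realType} {E Eu : rieszType R}.
Hypothesis E_ded : dedekind_complete E.
Context {iota : {linear E -> Eu}} {mul : Eu -> Eu -> Eu}.
Variables (e : E) (T : {linear E -> E}).
Hypotheses (e_unit : weak_order_unit e) (Te : T e = e) (T_ce : cond_exp T).
Hypothesis T_strict : strictly_positive T.
Hypotheses (iota_uc : universal_completion iota) (mulP : falgebra_mul mul (iota e)).
Variables (Tij : int -> int -> {linear E -> E}) (Tpast Tfut : int -> {linear E -> E}).
Hypothesis Tij_ce : forall i j : int, i <= j -> sub_ce T (Tij i j).
Hypotheses (past_ce : forall n, sub_ce T (Tpast n)) (fut_ce : forall n, sub_ce T (Tfut n)).
Hypothesis past_mono : forall n, range (Tpast n) `<=` range (Tpast (n + 1)).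
Hypothesis Tij_past : forall i j : int, i <= j -> range (Tij i j) `<=` range (Tpast j).
Hypothesis Tij_fut : forall i j : int, i <= j -> range (Tij i j) `<=` range (Tfut i).
Variables (p : exponent) (f d : int -> E) (xi : nat -> E) (G h : E).
Hypotheses (TG : range T G) (fG : forall n, rabs (f n) <= G) (dh : forall n, d n <= h).
Hypothesis f_ned : near_epoch_dependent_with iota mul T p Tij f d xi.
Hypothesis f_mean0 : forall n, T (f n) = 0.
Hypothesis mixing :
  alpha_mixing iota mul T e Tpast Tfut \/ phi_mixing iota mul T e Tpast Tfut.

Let e0 : 0 <= e. Proof. by case: e_unit. Qed.
Let G0 : 0 <= G. Proof. exact: le_trans (rabs_ge0 (f 0)) (fG 0). Qed.
Let window n (m : nat) := Tij (n - m%:Z) (n + m%:Z) (f n).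
Let le_window (n : int) (m : nat) : n - m%:Z <= n + m%:Z. Proof. by lia. Qed.

Let TGE : T G = G. Proof. exact: ce_fix. Qed.

Let window_le n m : rabs (window n m) <= G.
Proof.
have Us := Tij_ce (le_window n m); have [SG _] := proj2 Us G.
by rewrite TGE in SG; have := ce_abs_le (proj1 Us) (fG n); rewrite SG.
Qed.

Let T_window n m : T (window n m) = 0.
Proof. by rewrite sub_ce_T //; apply: Tij_ce. Qed.

(** The bound [mul (iota h) (iota (xi m))] is formed in [Eu], so the comparison takes place there;
    multiplication by a fixed positive element preserves null sequences. *)
Lemma near_epoch_null : ocvg0_uniformly (fun n m => T (rabs (f n - window n m))).
Proof.
case: f_ned => _ d0 xi_pos [v [va v0 [M xiv]]] ned.
have h0 : 0 <= h by apply: le_trans (dh 0); case: (d0 0).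
apply: (ocvg0_uniformly_limsup E_ded iota_uc (H := G + G)) => [n m _|w w0 wz].
  apply/andP; split; first exact: cond_exp_pos.
  rewrite -TGE -linearD; apply: ce_le => //.
  by apply: le_trans (rabsB _ _) _; apply: riesz_leD.
have ie0 : 0 <= iota e by apply/(embed_ge0 iota_uc).
have ih0 : 0 <= iota h by apply/(embed_ge0 iota_uc).
have iw0 : 0 <= iota w by apply/(embed_ge0 iota_uc).
apply/(embed_le iota_uc); rewrite linear0.
rewrite (falg_null_product (completion_ded iota_uc) mulP ie0 ih0 iw0
  (embed_null iota_uc v0)) //.
(* The shift by [M] is due to the merely eventual domination of [xi] by [v]. *)
move=> k; apply: (wz (M + k)%N) => n m Mm m0.
have [s sP sle] := ned n m m0.
apply: le_trans (_ : _ <= iota s) _.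
  by apply/(embed_le iota_uc); apply: (L1_le_Lp_norm e_unit Te T_ce iota_uc mulP sP).
have [_ xi0] := xi_pos m m0.
apply: le_trans sle _; apply: le_trans (_ : _ <= mul (iota h) (iota (xi m))) _.
  apply: (falg_le_mulr mulP); first exact/(embed_ge0 iota_uc).
  exact/(embed_le iota_uc).
apply: (falg_le_mull mulP) => //; apply/(embed_le iota_uc).
apply: le_trans (rabs_ge _) _; have Mm' : (M <= m)%N by lia.
have := xiv m Mm'; rewrite subr0 => /le_trans; apply; apply: va; lia.
Qed.

(** The window starts at [n - m] and the past ends at [n - 2 m], leaving the gap [m] for mixing.
    Since the window has mean zero, its truncation has mean at most [r] in absolute value, which
    mixing multiplies by 3; undoing the truncation adds one more [r]. *)
Lemma past_mean_null :
  ocvg0_uniformly (fun n m => T (rabs (Tpast (n - m%:Z - m%:Z) (window n m)))).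
Proof.
have [v [M [va v0 vP]]] :=
  mixing_mean_bound E_ded e_unit Te T_ce iota_uc mulP past_ce fut_ce mixing.
apply: (ocvg0_uniformly_limsup E_ded iota_uc (H := G)) => [n m _|w w0 wz].
  apply/andP; split; first exact: cond_exp_pos.
  apply: le_trans (T_abs_ce T_ce _ (past_ce _)) _.
  by rewrite -[X in _ <= X]TGE; apply: ce_le.
pose r (K : nat) := rpos (G - K%:R *: e).
(* The successor provides the positive level that the mixing estimate requires; monotonicity of [r]
   returns to [K]. *)
suff key K : w <= 4 *: r K.+1.
  apply: (le0_of_truncation E_ded e_unit G0 (ler0n R 4)) => K.
  apply: le_trans (key K) _; apply: riesz_lerZ => //; apply: rposS.
  by apply: (riesz_le_by e0); rewrite -natr1; vring.
have K0 : 0 < K.+1%:R :> R by rewrite ltr0Sn.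
have Ke0 : 0 <= K.+1%:R *: e by apply: riesz_scale_ge0.
have Tr : T (r K.+1) = r K.+1.
  apply: ce_fix => //; apply: range_rpos => //.
  exact: (range_sub_e Te) (sub_ce_refl T_ce) TG.
have K40 : 0 <= 4 * K.+1%:R :> R by apply: mulr_ge0.
suff le : w - 4 *: r K.+1 <= 0 by apply: (riesz_le_by le); vring.
apply/(embed_le iota_uc); rewrite linear0; apply: (le0_of_null v0 K40) => k.
have {wz}wz := wz (M + k)%N; rewrite linearB linearZ /=.
suff le : iota w <= (4 * K.+1%:R) *: v k + 4 *: iota (r K.+1).
  by apply: (riesz_le_by le); vring.
apply: wz => n m Mm m0; have Mm' : (M <= m)%N by lia.
set y := window n m; pose z := rtrunc (K.+1%:R *: e) y.
have yz : T (rabs (y - z)) <= r K.+1.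
  rewrite -Tr; apply: ce_le => //; apply: rtrunc_close; exact: window_le.
have Tz : rabs (T z) <= r K.+1.
  have -> : T z = - T (y - z) by rewrite linearB /= T_window; vring.
  by rewrite rabsN; apply: le_trans (ce_abs _ _) yz.
have zV : range (Tfut (n - m%:Z - m%:Z + m%:Z)) z.
  rewrite subrK; apply: (range_rtrunc Te _ (fut_ce _)).
  by apply: (Tij_fut (le_window n m)); exists (f n).
have := vP (n - m%:Z - m%:Z) m z _ _ Mm' m0 zV (rtrunc_abs _ Ke0) K0 Tz.
have le : T (rabs (Tpast (n - m%:Z - m%:Z) y)) <=
    T (rabs (Tpast (n - m%:Z - m%:Z) z)) + r K.+1.
  have h1 := le_trans (T_abs_ce T_ce (y - z) (past_ce (n - m%:Z - m%:Z))) yz.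
  have h2 : rabs (Tpast (n - m%:Z - m%:Z) y) <=
      rabs (Tpast (n - m%:Z - m%:Z) z) + rabs (Tpast (n - m%:Z - m%:Z) (y - z)).
    have -> : Tpast (n - m%:Z - m%:Z) y =
        Tpast (n - m%:Z - m%:Z) z + Tpast (n - m%:Z - m%:Z) (y - z).
      by rewrite linearB /=; vring.
    exact: rabsD.
  have := ce_le T_ce h2; rewrite [T (_ + _)]linearD /= => {}h2.
  by apply: (riesz_le_by (riesz_leD h1 h2)); vring.
move/(embed_le iota_uc): le; rewrite [iota (_ + _)]linearD /= => le1 le2.
have kM : (k <= m)%N by lia.
have le3 := riesz_lerZ _ _ _ K40 (va k m kM).
by apply: (riesz_le_by (riesz_leD le1 (riesz_leD le2 le3))); vring.
Qed.

(** The upper end of the telescope contributes [2 b M], because the past at [i + M] fixes the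
    window; the lower end contributes [b M + c M]. Hence the coefficients 3 and 1. *)
Lemma block_mean_null : ocvg0_uniformly (fun n m => T (rabs (block_mean f n m))).
Proof.
have [b [Mb [ba b0 bP]]] := ocvg0_uniformly_dominated near_epoch_null.
have [c [Mc [ca c0 cP]]] := ocvg0_uniformly_dominated past_mean_null.
apply: (ocvg0_uniformly_limsup E_ded iota_uc (H := G)) => [n m m0|w w0 wz].
  apply/andP; split; first exact: cond_exp_pos.
  rewrite -[X in _ <= X]TGE; apply: ce_le => //.
  have m_gt0 : 0 < m%:R :> R by rewrite ltr0n.
  rewrite /block_mean rabsZ ?invr_ge0 //; apply: (riesz_le_unscale m_gt0).
  rewrite scalerA mulfV ?gt_eqF // scale1r big_add1 /= big_mkord.
  apply: le_trans (rabs_sum_le _ _ _) _.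
  rewrite scaler_nat -[in X in _ <= X](card_ord m) -sumr_const.
  by apply: riesz_sum_le => k _; apply: fG.
apply: (le0_of_truncation E_ded e_unit G0 (ler0n R 4)) => K.
set r := rpos _; suff le : w - 4 *: r <= 0 by apply: (riesz_le_by le); vring.
apply: (le0_of_nullD ba ca b0 c0 (ler0n R 3) ler01 (m0 := (Mb + Mc).+1)) => M leM.
have M0 : (0 < M)%N by lia.
have fA i : T (rabs (f i - Tpast (i + M%:Z) (f i))) <= 2 *: b M.
  have Mb' : (Mb <= M)%N by lia.
  have h1 := bP i M Mb' M0; set U := Tpast _.
  have Uw : U (window i M) = window i M.
    apply: ce_fix; first by case: (past_ce (i + M%:Z)).
    by apply: (Tij_past (le_window i M)); exists (f i).
  have h2 := le_trans (T_abs_ce T_ce (f i - window i M) (past_ce (i + M%:Z))) h1.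
  have le : rabs (f i - U (f i)) <= rabs (f i - window i M) + rabs (U (f i - window i M)).
    have -> : f i - U (f i) = (f i - window i M) - U (f i - window i M).
      by rewrite linearB /= Uw; vring.
    exact: rabsB.
  have := ce_le T_ce le; rewrite [T (_ + _)]linearD /= => {}le.
  by apply: (riesz_le_by (riesz_leD le (riesz_leD h1 h2))); vring.
have fB i : T (rabs (Tpast (i - M%:Z - M%:Z) (f i))) <= b M + c M.
  have Mb' : (Mb <= M)%N by lia.
  have Mc' : (Mc <= M)%N by lia.
  have h1 := bP i M Mb' M0; have h2 := cP i M Mc' M0; set U := Tpast _ in h2 *.
  have h3 := le_trans (T_abs_ce T_ce (f i - window i M) (past_ce (i - M%:Z - M%:Z))) h1.
  have le : rabs (U (f i)) <= rabs (U (f i - window i M)) + rabs (U (window i M)).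
    have -> : U (f i) = U (f i - window i M) + U (window i M).
      by rewrite linearB /=; vring.
    exact: rabsD.
  have := ce_le T_ce le; rewrite [T (_ + _)]linearD /= => {}le.
  by apply: (riesz_le_by (riesz_leD le (riesz_leD h3 h2))); vring.
suff le : w - (4 *: r + 3 *: b M + c M) <= 0 by apply: (riesz_le_by le); vring.
apply: (@riesz_archimedean _ _ E_ded _ (((3 * M)%:R * (12 * K%:R)) *: e)) => -[|N].
  by rewrite scale0r; apply: riesz_scale_ge0 => //; rewrite !mulr_ge0.
set bound := 2 *: b M + (b M + c M) + 4 *: r + ((3 * M)%:R * (12 * K%:R / N.+1%:R)) *: e.
have le : w <= bound.
  (* Writing [s] for [N + 1], blocks of length at least [s^2] bring [8 K s / m] down to [8 K / s];
     with the other term [4 K / s] this gives the 12. *)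
  apply/(embed_le iota_uc); apply: (wz (N.+1 * N.+1)%N) => n m Nm m0.
  apply/(embed_le iota_uc).
  apply: le_trans (mixingale_mean_bound E_ded e_unit Te T_ce T_strict past_ce past_mono
    K n fG TG (ltn0Sn N) m0 fA fB) _.
  apply: riesz_leD => //; apply: riesz_scale2 => //; apply: ler_wpM2l => //.
  have N_gt0 : 0 < N.+1%:R :> R by rewrite ltr0Sn.
  have m_gt0 : 0 < m%:R :> R by rewrite ltr0n.
  suff : 8 * K%:R * N.+1%:R / m%:R <= 8 * K%:R / N.+1%:R :> R.
    have -> : 12 * K%:R / N.+1%:R = 8 * K%:R / N.+1%:R + 4 * K%:R / N.+1%:R :> R.
      by rewrite -mulrDl -mulrDl; congr (_ * _ / _); ring.
    by rewrite lerD2r.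
  rewrite ler_pdivrMr // [X in _ <= X]mulrAC ler_pdivlMr //.
  rewrite -!mulrA ler_wpM2l // ler_wpM2l //.
  by rewrite -natrM ler_nat.
have h1 := riesz_lerZ N.+1%:R _ _ (ler0n _ _) le.
apply: (riesz_le_by h1); rewrite /bound.
have N_neq0 : N.+1%:R != 0 :> R by rewrite pnatr_eq0.
move: (3 * M)%N => M3; move: (N.+1%:R) N_neq0 => t t0.
by vfield; rewrite t0.
Qed.

End NearEpochDependence.

(** * Reduction of both growth conditions to one dominating element *)

Theorem corollary4p11 (R : realType) (E Eu : rieszType R)
    (iota : {linear E -> Eu}) (mul : Eu -> Eu -> Eu)
    (T : {linear E -> E}) (e : E)
    (Tij : int -> int -> {linear E -> E})
    (Tpast Tfut : int -> {linear E -> E})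
    (p : exponent) (f d g : int -> E) (xi : nat -> E)
    (E_dedekind : dedekind_complete E)
    (e_unit : weak_order_unit e)
    (Te : T e = e)
    (T_cond_exp : cond_exp T)
    (T_strict : strictly_positive T)
    (iota_uc : universal_completion iota)
    (mul_falg : falgebra_mul mul (iota e))
    (E_Tuc : T_universally_complete iota T)
    (Tij_cond_exp : forall i j : int, i <= j ->
       cond_exp (Tij i j) /\ compatible T (Tij i j))
    (Tij_range : forall i j : int, i < j ->
       range (Tij (i + 1) j) `<=` range (Tij i j) /\
       range (Tij i j) `<=` range (Tij i (j + 1)))
    (TpastP : forall n : int,
       [/\ cond_exp (Tpast n), compatible T (Tpast n) &
           range (Tpast n) =
             riesz_closure (\bigcup_(i in [set i : int | i <= n]) range (Tij i n))])
    (TfutP : forall n : int,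
       [/\ cond_exp (Tfut n), compatible T (Tfut n) &
           range (Tfut n) =
             riesz_closure (\bigcup_(j in [set j : int | n <= j]) range (Tij n j))])
    (f_Linfty : forall n, Lp iota mul T p_infty (f n))
    (f_ned : near_epoch_dependent_with iota mul T p Tij f d xi)
    (g_range : forall n, range_pos T (g n))
    (f_le_g : forall n, rabs (f n) <= g n)
    (f_uniform : T_uniform T e f)
    (f_mean0 : forall n, T (f n) = 0)
    (mixing : alpha_mixing iota mul T e Tpast Tfut \/
              phi_mixing iota mul T e Tpast Tfut) :
  (bounded_uniformly (block_mean (fun i => d i \vee g i)) ->
     ocvg0_uniformly (fun n m => T (rabs (block_mean f n m)))) /\
  ((forall n, d n \vee g n = T (rabs (f n))) ->
     ocvg0_uniformly (fun n m => T (rabs (block_mean f n m)))).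
Proof.
have past_ce n : sub_ce T (Tpast n) by case: (TpastP n).
have fut_ce n : sub_ce T (Tfut n) by case: (TfutP n).
have past_mono n : range (Tpast n) `<=` range (Tpast (n + 1)).
  case: (TpastP n) => _ _ ->; case: (TpastP (n + 1)) => _ _ ->.
  apply: riesz_closure_mono => x [i /= le_in Tx].
  have [lt_in|ge_in] := ltP i n.
    by exists i => /=; [lia|have [_] := Tij_range _ _ lt_in; apply].
  (* The range inclusions are given for [i < j] only, so the range at [(n, n)] reaches the past of
     [n + 1] through [(n - 1, n)] and [(n - 1, n + 1)]. *)
  have i_n : i = n by lia.
  have lt_n : n - 1 < n by lia.
  have [sub1 sub2] := Tij_range _ _ lt_n; rewrite subrK in sub1.
  by exists (n - 1) => /=; [lia|apply/sub2/sub1; rewrite -{1}i_n].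
have Tij_past (i j : int) : i <= j -> range (Tij i j) `<=` range (Tpast j).
  case: (TpastP j) => _ _ -> ij x Tx.
  by apply: sub_riesz_closure; exists i.
have Tij_fut (i j : int) : i <= j -> range (Tij i j) `<=` range (Tfut i).
  case: (TfutP i) => _ _ -> ij x Tx.
  by apply: sub_riesz_closure; exists j.
have dominated h : (forall n, d n <= h) -> (forall n, g n <= h) ->
    ocvg0_uniformly (fun n m => T (rabs (block_mean f n m))).
  move=> dh gh; have TTh : range T (T h) by exists h.
  apply: (block_mean_null E_dedekind e_unit Te T_cond_exp T_strict iota_uc mul_falg
    Tij_cond_exp past_ce fut_ce past_mono Tij_past Tij_fut TTh _ dh f_ned f_mean0 mixing).
  move=> n; apply: le_trans (f_le_g n) _; have [Tg _] := g_range n.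
  by rewrite -(ce_fix T_cond_exp Tg); apply: ce_le.
split=> [[h _ hP]|dgE].
  have dg n : d n \vee g n <= h.
    have := hP (n - 1) 1%N isT; rewrite /block_mean big_nat1 invr1 scale1r.
    by rewrite subrK.
  by apply: (dominated h) => n; apply: le_trans (dg n); apply rjoin_ub.
have [H fH] := T_uniform_bounded E_dedekind e_unit Te T_cond_exp f_uniform.
by apply: (dominated H) => n; apply: le_trans (fH n); rewrite -dgE; apply rjoin_ub.
Qed.
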